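(* Let $d,e\ge3$ be natural numbers and $l=1+\frac{d^2+e^2-3e-3d}{2}$. Let $C_1$ be a tropical curve of degree $d$, $C_2$ a tropical curve of degree $e$, and $p_1,\dots,p_l\in\mathbb{T}^2$ any points. Let $\{q_1,\dots,q_{de}\}$ be the stable intersection of $C_1$ and $C_2$ (counted with multiplicities). Then there is a tropical curve of degree $d+e-3$ containing all the points $\{q_1,\dots,q_{de}\}\cup\{p_1,\dots,p_l\}$.
   Context: $\mathbb{T}$, with $\mathbb{Q}\subseteq\mathbb{T}\subseteq\mathbb{R}$, is the value group of an algebraically closed field with a non-trivial rank one valuation (so a divisible subgroup of $\mathbb{R}$), with tropical operations $\max$ and $+$. A tropical curve of degree $m$ is the set of $(x,y)\in\mathbb{T}^2$ at which the maximum $\max\{a_{ij}+ix+jy: i,j\ge0,\ i+j\le m\}$ is attained at least twice, for some coefficients $a_{ij}\in\mathbb{T}$. For convex lattice polygons (possibly degenerate), $\mathcal{M}(P,Q)=\mathrm{area}(P+Q)-\mathrm{area}(P)-\mathrm{area}(Q)$. The stable intersection of the tropical curves of $f$ and $g$ is the finite multiset in which a point $p\in\mathbb{T}^2$ has multiplicity $\mathcal{M}(P_p,Q_p)$, where $P_p$ (resp. $Q_p$) is the convex hull of the exponents attaining the maximum of $f$ (resp. $g$) at $p$; equivalently, it is the limit of the transversal intersections of generic perturbations. For curves of degrees $d$ and $e$ it has $de$ elements. *)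

(* Defs.v *)
From HB Require Import structures.
From mathcomp Require Import all_boot all_order all_algebra.
From mathcomp Require Import all_classical all_reals all_analysis.

Set Implicit Arguments.
Unset Strict Implicit.
Unset Printing Implicit Defensive.

Import Order.TTheory GRing.Theory Num.Theory.
Import numFieldNormedType.Exports.

Local Open Scope classical_set_scope.
Local Open Scope ring_scope.

(* A non-trivial valuation of rank one, i.e. with values in the ordered group
   of the reals. Only the values on nonzero elements are meaningful: [v 0],
   classically +oo, is unconstrained and never used. *)
Record rank_one_valuation (R : realType) (K : fieldType) (v : K -> R) : Prop :=
  RankOneValuation {
    valuation_mul : forall x y : K, x != 0 -> y != 0 -> v (x * y) = v x + v y;
    valuation_add : forall x y : K, x != 0 -> y != 0 -> x + y != 0 ->
      Num.min (v x) (v y) <= v (x + y);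
    valuation_nontrivial : exists x : K, x != 0 /\ v x != 0 }.

Definition value_group (R : realType) (K : fieldType) (v : K -> R) : set R :=
  v @` [set x | x != 0].

Definition exponents (m : nat) : set (nat * nat) :=
  [set u | (u.1 + u.2 <= m)%N].

(* The coefficient a_ij of a tropical polynomial of degree m is [a i j]; the
   values [a i j] with i + j > m are ignored. *)
Definition tropical_polynomial (R : realType) (T : set R) (m : nat)
    (a : nat -> nat -> R) : Prop :=
  forall u, exponents m u -> T (a u.1 u.2).

Definition tropical_monomial (R : realType) (a : nat -> nat -> R)
    (u : nat * nat) (p : R * R) : R :=
  a u.1 u.2 + u.1%:R * p.1 + u.2%:R * p.2.

Definition maximal_exponents (R : realType) (m : nat) (a : nat -> nat -> R)
    (p : R * R) : set (nat * nat) :=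
  [set u | exponents m u /\
     forall w, exponents m w ->
       tropical_monomial a w p <= tropical_monomial a u p].

Definition tropical_zeros (R : realType) (T : set R) (m : nat)
    (a : nat -> nat -> R) : set (R * R) :=
  [set p | (T `*` T) p /\
     exists u w, [/\ maximal_exponents m a p u, maximal_exponents m a p w
                   & u <> w]].

Definition tropical_curve (R : realType) (T : set R) (m : nat)
    (C : set (R * R)) : Prop :=
  exists a, tropical_polynomial T m a /\ C = tropical_zeros T m a.

Definition convex_hull (R : realType) (A : set (R * R)) : set (R * R) :=
  smallest (@convex_set R (R^o * R^o)%type) A.

Definition lattice_polygon (R : realType) (A : set (nat * nat)) : set (R * R) :=
  convex_hull [set (u.1%:R, u.2%:R) | u in A].

Definition minkowski_sum (R : realType) (P Q : set (R * R)) : set (R * R) :=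
  [set (x.1 + y.1, x.2 + y.2) | x in P & y in Q].

Definition area (R : realType) (P : set (R * R)) : R :=
  fine ((@lebesgue_measure R \x @lebesgue_measure R)%E P).

Definition mixed_area (R : realType) (P Q : set (R * R)) : R :=
  area (minkowski_sum P Q) - area P - area Q.

(* The stable intersection of the curves of f and g, as the multiset given by
   its multiplicity function on T^2. It depends on the polynomials and not
   only on their zero sets, which do not determine the weights of the edges. *)
Definition stable_intersection (R : realType) (T : set R) (d e : nat)
    (f g : nat -> nat -> R) (q : R * R) : R :=
  if q \in T `*` T then
    mixed_area (@lattice_polygon R (maximal_exponents d f q))
               (@lattice_polygon R (maximal_exponents e g q))
  else 0.

(* Main.v *)
Require Import Defs.
From mathcomp Require Import all_boot all_order all_algebra.
From mathcomp Require Import fingroup perm.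
From mathcomp Require Import all_classical all_reals all_analysis.
From mathcomp Require Import measurable_realfun.
From mathcomp Require Import ring lra zify.

Set Implicit Arguments.
Unset Strict Implicit.
Unset Printing Implicit Defensive.

Import Order.TTheory GRing.Theory Num.Theory.
Import numFieldNormedType.Exports.

Local Open Scope classical_set_scope.
Local Open Scope ring_scope.

(* Any N - 1 points lie on a tropical curve whose polynomial has N monomials,
   and here N = d e + l; only the case of d e distinct stable intersection
   points, all of multiplicity one, needs an argument. By the tropical Cramer
   rule a curve passes through N points if the N x N matrix of the values of the
   monomials at the points has two optimal permutations, and for that it suffices
   that some of its rows are tropically dependent. Having two optimal
   permutations is a closed condition, so g may be replaced by a small generic
   translate.
   A dependency between the d e rows is a tropical form of the Euler-Jacobi
   formula: for u in the interior of (d + e) Delta, the minimum over the stable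
   points of the convex function phi = f + g - u is attained twice. Indeed, by
   unimodularity, a stable point q is the maximum of phi on one of the four cells
   of the complement of the two curves that meet at q; this cell is bounded by
   edges of both curves, so its boundary switches between them at a second
   stable point, where phi <= phi(q).
   The bound d e on the number of stable points, with equality only if all of
   them are unimodular, is obtained by counting, instead of areas, the points of
   a generic translate of Z^2 in the cells of the mixed subdivision. *)

(** * Area of planar sets *)

(** Areas serve a single implication: a nonzero mixed area forces two non-parallel edges, one in
    each local polygon ([crossing]). Everything after it concerns finitely many linear inequalities.
    The perturbation takes place in R and not in T. It only shows that the matrix of the unperturbed
    points is singular; the curve is read off from that matrix, whose tropical minors are sums of
    its entries and so stay in T. The count needs no subdivision as a geometric object. It is enough
    that a shifted lattice point belongs to the cell of at most one point of the plane, and that the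
    vertices of f and g own d(d+1)/2 and e(e+1)/2 of the (d+e)(d+e+1)/2 shifted points: d e of them
    remain for the crossings. The shift keeps these points off the boundaries of the cells. Equality
    in the bound is used twice: it makes every given crossing unimodular, and it makes the second
    crossing found on the boundary of a cell one of the given points. *)

Section PlaneMeasure.
Variable R : realType.
Implicit Types (A Q : set (R * R)) (a b x : R * R).

Lemma measurable_translation (c : R) :
  measurable_fun (setT : set (measurableTypeR R))
    ((fun t : R => c + t) : measurableTypeR R -> measurableTypeR R).
Proof.
have cf : continuous (fun t : R => c + t).
  by move=> t; apply: cvgD; [exact: cvg_cst | exact: cvg_id].
exact: continuous_measurable_fun cf.
Qed.

Lemma lebesgue_measure_translation (c : R) (S : set (measurableTypeR R)) :
  measurable S ->
  lebesgue_measure ((fun t : R => c + t) @^-1` S) = lebesgue_measure S.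
Proof.
move=> mS; apply/esym.
have mc := measurable_translation c.
apply: (@lebesgue_measure_unique R (pushforward lebesgue_measure
  ((fun t : R => c + t) : measurableTypeR R -> measurableTypeR R))) => //.
move=> _ [[s t]] _ <- /=.
rewrite /pushforward.
have -> : (fun r : R => c + r) @^-1` `]s, t]%classic = `]s - c, t - c]%classic.
  by apply/seteqP; split => r /=; rewrite !in_itv/= => /andP[h1 h2];
    apply/andP; split; lra.
rewrite !lebesgue_measure_itv/= !lte_fin ltrD2r.
by case: ifP => // _; rewrite -!EFinB; congr EFin; ring.
Qed.

Lemma area_translation a Q : measurable (Q : set (R * R)) ->
  area [set (a.1 + y.1, a.2 + y.2) | y in Q] = area Q.
Proof.
move=> mQ; rewrite /area; congr fine.
rewrite /product_measure1.
pose g : measurableTypeR R -> \bar R := (@lebesgue_measure R \o xsection Q)%E.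
have mg : measurable_fun setT g.
  exact: (measurable_fun_xsection (@lebesgue_measure R)).
have mc := measurable_translation (- a.1).
transitivity (\int[lebesgue_measure]_x g (- a.1 + x)%R)%E.
  apply: eq_integral => x _ /=; rewrite /g /=.
  have -> : xsection [set (a.1 + y.1, a.2 + y.2) | y in Q] x =
      (fun t : R => - a.2 + t) @^-1` (xsection Q (- a.1 + x)).
    apply/seteqP; split => t /=; rewrite /xsection/= !inE/=.
      by move=> [[y1 y2] /= yQ [<- <-]]; rewrite !addKr.
    by move=> tQ; exists (- a.1 + x, - a.2 + t) => //=; rewrite !addNKr.
  apply: lebesgue_measure_translation.
  exact: measurable_xsection.
have := @ge0_integral_pushforward _ _ _ _ R _ mc (@lebesgue_measure R) setT g
  measurableT mg (fun _ _ => measure_ge0 _ _).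
rewrite preimage_setT => <-.
apply: eq_measure_integral => S mS _.
exact: lebesgue_measure_translation.
Qed.

(** The vertical sections decide: a non-vertical line meets each of them in at most one point, and a
    vertical line has its only nonempty section over a single abscissa, a null set. *)
Lemma area_line_eq0 (n1 n2 c : R) A : (n1 != 0) || (n2 != 0) ->
  (forall x, A x -> n1 * x.1 + n2 * x.2 = c) -> area A = 0.
Proof.
move=> n0 Ac; rewrite /area /product_measure1.
have [n20|n20] := eqVneq n2 0; last first.
  rewrite (_ : (_ \o _) = fun=> 0%E) ?integral0//.
  apply/funext => x /=.
  have : xsection A x `<=` [set (c - n1 * x) / n2].
    move=> t; rewrite /xsection/= inE => /Ac /= <-.
    by rewrite addrAC subrr add0r mulrC mulKf.
  move/subset_set1 => [->|->]; first by rewrite measure0.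
  exact: lebesgue_measure_set1.
move: n0; rewrite n20 eqxx orbF => n10.
pose x0 := c / n1.
rewrite (_ : (_ \o _) = ((@lebesgue_measure R \o xsection A) \_ [set x0])); last first.
  apply/funext => x /=; rewrite patchE; case: ifPn => // /negP xx0.
  rewrite (_ : xsection A x = set0) ?measure0//.
  apply/seteqP; split => // t; rewrite /xsection/= inE => /Ac /= h.
  by apply: xx0; rewrite inE /= /x0 -h n20 mul0r addr0 mulrC mulKf.
rewrite -integral_mkcond.
rewrite (eq_integral (cst (lebesgue_measure (xsection A x0)))); last first.
  by move=> x; rewrite inE /= => ->.
rewrite integral_cst; last exact: measurable_set1.
by rewrite [X in (_ * X)%E](lebesgue_measure_set1 x0) mule0.
Qed.

(** The sigma-algebra of the plane is generated by products, so [U] is written as a countable union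
    of boxes with rational centres and radii. *)
Lemma open_measurable_plane (U : set (R * R)) :
  open U -> measurable (U : set (R * R)).
Proof.
move=> oU.
pose B (p q r : rat) : set (R * R) :=
  (ball (ratr p : R) (ratr r : R)) `*` (ball (ratr q : R) (ratr r : R)).
rewrite (_ : U = \bigcup_(p : rat) \bigcup_(q : rat) \bigcup_(r : rat)
   (if `[< B p q r `<=` U >] then B p q r else set0)); last first.
  apply/seteqP; split => x.
    move=> Ux.
    have /nbhs_ballP [e /= e0 eU] : nbhs x U by exact: open_nbhs_nbhs.
    (* The centre is within e/4 of x and the radius is between e/4 and e/2, so the box contains x
       and stays within e of it. *)
    have e40 : 0 < e / 4 by lra.
    have /rat_in_itvoo[p] : x.1 - e / 4 < x.1 + e / 4 by lra.
    have /rat_in_itvoo[q] : x.2 - e / 4 < x.2 + e / 4 by lra.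
    have /rat_in_itvoo[r] : e / 4 < e / 2 by lra.
    rewrite !in_itv/= => /andP[r1 r2] /andP[q1 q2] /andP[p1 p2].
    exists p => //; exists q => //; exists r => //.
    have BU : B p q r `<=` U.
      move=> [y1 y2] [/= hy1 hy2]; apply: eU; split => /=.
        move: hy1; rewrite /ball/= !ltr_norml => /andP[? ?].
        by apply/andP; split; lra.
      move: hy2; rewrite /ball/= !ltr_norml => /andP[? ?].
      by apply/andP; split; lra.
    case: asboolP => // _; split; rewrite /ball/= ltr_norml; apply/andP; split; lra.
  move=> [p _ [q _ [r _]]]; case: asboolP => // BU; exact: BU.
apply: bigcupT_measurable_rat => p; apply: bigcupT_measurable_rat => q.
apply: bigcupT_measurable_rat => r; case: asboolP => // _.
by apply: measurableX; exact: measurable_ball.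
Qed.

Lemma compact_measurable_plane (K : set (R * R)) :
  compact (K : set (R^o * R^o)) -> measurable (K : set (R * R)).
Proof.
move=> cK.
have : closed (K : set (R^o * R^o)) by apply: compact_closed cK; exact: norm_hausdorff.
move=> clK; rewrite -(setCK K); apply: measurableC.
by apply: open_measurable_plane; exact: closed_openC.
Qed.

End PlaneMeasure.

(** * Convex hulls of finite sets of points *)

Section PlaneConvexHull.
Variable R : realType.
Implicit Types (A Q : set (R * R)) (a b x : R * R).
Lemma convex_setP A : @convex_set R (R^o * R^o)%type A <->
  forall x y t, 0 <= t <= 1 -> A x -> A y ->
    A (t * x.1 + (1 - t) * y.1, t * x.2 + (1 - t) * y.2).
Proof.
split=> [cA x y t /andP[t0 t1] Ax Ay | cA x y l].
  have := cA x y (Itv01 t0 t1); rewrite !inE => /(_ Ax Ay); exact.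
rewrite !inE => Ax Ay; apply: (cA x y l%:num) => //.
by apply/andP; split.
Qed.
Lemma convex_line (n1 n2 c : R) :
  @convex_set R (R^o * R^o)%type [set x | n1 * x.1 + n2 * x.2 = c].
Proof.
apply/convex_setP => x y t _ /= hx hy.
transitivity (t * (n1 * x.1 + n2 * x.2) + (1 - t) * (n1 * y.1 + n2 * y.2)); first ring.
by rewrite hx hy; ring.
Qed.
Lemma convex_hull_set1 a : convex_hull [set a] = [set a].
Proof.
apply/seteqP; split; last exact: sub_gen_smallest.
apply: smallest_sub => //; apply/convex_setP => x y t _ -> -> /=.
by rewrite [RHS]surjective_pairing; congr pair; ring.
Qed.
(** The union of the segments from [a] to [K]. The point [a] is added by hand because the image is
    empty when [K] is, as happens at the end of the induction on lists below. *)
Definition join_point a (K : set (R * R)) : set (R * R) :=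
  a |` [set (z.1 * a.1 + (1 - z.1) * z.2.1, z.1 * a.2 + (1 - z.1) * z.2.2)
       | z in `[0, 1] `*` K].

Lemma compact_join_point a (K : set (R * R)) :
  compact (K : set (R^o * R^o)) -> compact (join_point a K : set (R^o * R^o)).
Proof.
move=> cK; apply: compactU; first exact: compact_set1.
apply: (@continuous_compact (R * (R^o * R^o))%type (R^o * R^o)%type
  (fun z => (z.1 * a.1 + (1 - z.1) * z.2.1, z.1 * a.2 + (1 - z.1) * z.2.2))).
  apply: continuous_subspaceT => z.
  have c1 : {for z, continuous (fun z : R * (R^o * R^o) => z.1)} by exact: cvg_fst.
  have c2 : {for z, continuous (fun z : R * (R^o * R^o) => z.2)} by exact: cvg_snd.
  have c21 : {for z, continuous (fun z : R * (R^o * R^o) => (z.2.1 : R))}.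
    by apply: (@continuous_comp _ _ _ (fun z : R * (R^o * R^o) => z.2) fst) => //; exact: cvg_fst.
  have c22 : {for z, continuous (fun z : R * (R^o * R^o) => (z.2.2 : R))}.
    by apply: (@continuous_comp _ _ _ (fun z : R * (R^o * R^o) => z.2) snd) => //; exact: cvg_snd.
  have c0 : {for z, continuous (fun z : R * (R^o * R^o) => 1 - z.1)}.
    by apply: cvgB => //; exact: cvg_cst.
  suff h : forall b : R, {for z, continuous (fun z : R * (R^o * R^o) => z.1 * b + (1 - z.1) * z.2.1)} /\ {for z, continuous (fun z : R * (R^o * R^o) => z.1 * b + (1 - z.1) * z.2.2)}.
    exact: (cvg_pair (h a.1).1 (h a.2).2).
  move=> b; split.
    by apply: cvgD; apply: cvgM => //; exact: cvg_cst.
  by apply: cvgD; apply: cvgM => //; exact: cvg_cst.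
by apply: compact_setX => //; exact: segment_compact.
Qed.

Lemma convex_join_point a (K : set (R * R)) :
  @convex_set R (R^o * R^o)%type K -> @convex_set R (R^o * R^o)%type (join_point a K).
Proof.
move=> /convex_setP cK; apply/convex_setP.
have JP x : join_point a K x -> x = a \/ exists k s, [/\ K k, 0 <= s <= 1 &
    x = (s * a.1 + (1 - s) * k.1, s * a.2 + (1 - s) * k.2)].
  move=> [->|[[s k] /= [+ Kk] <-]]; first by left.
  by rewrite in_itv/= => s01; right; exists k, s.
have PJ k s : K k -> 0 <= s <= 1 -> join_point a K (s * a.1 + (1 - s) * k.1, s * a.2 + (1 - s) * k.2).
  by move=> Kk s01; right; exists (s, k); rewrite //= in_itv.
move=> x y t /andP[t0 t1] /JP[->|[k [s [Kk /andP[s0 s1] ->]]]] /JP[->|[k' [s' [Kk' /andP[s'0 s'1] ->]]]] /=.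
- by left; rewrite /= [RHS]surjective_pairing; congr pair; ring.
- have -> : (t * a.1 + (1 - t) * (s' * a.1 + (1 - s') * k'.1),
    t * a.2 + (1 - t) * (s' * a.2 + (1 - s') * k'.2)) =
    ((t + (1 - t) * s') * a.1 + (1 - (t + (1 - t) * s')) * k'.1,
     (t + (1 - t) * s') * a.2 + (1 - (t + (1 - t) * s')) * k'.2).
    by congr pair; ring.
  by apply: PJ => //; apply/andP; split; nra.
- have -> : (t * (s * a.1 + (1 - s) * k.1) + (1 - t) * a.1,
    t * (s * a.2 + (1 - s) * k.2) + (1 - t) * a.2) =
    ((t * s + (1 - t)) * a.1 + (1 - (t * s + (1 - t))) * k.1,
     (t * s + (1 - t)) * a.2 + (1 - (t * s + (1 - t))) * k.2).
    by congr pair; ring.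
  by apply: PJ => //; apply/andP; split; nra.
(* The combination puts weights [c] and [c'] on [k] and [k']. These two merge into one point of [K]
   of weight [c + c'], unless both weights vanish and the point is [a]. *)
- pose c := t * (1 - s); pose c' := (1 - t) * (1 - s').
  have c0 : 0 <= c by rewrite mulr_ge0// subr_ge0.
  have c'0 : 0 <= c' by rewrite mulr_ge0// subr_ge0.
  have cc1 : c + c' <= 1 by rewrite /c /c'; nra.
  have [e0|n0] := eqVneq (c + c') 0.
    have cz : c = 0 by lra.
    have c'z : c' = 0 by lra.
    left; rewrite /= [RHS]surjective_pairing; congr pair.
      transitivity (a.1 + c * (k.1 - a.1) + c' * (k'.1 - a.1)); first by rewrite /c /c'; ring.
      by rewrite cz c'z; ring.
    transitivity (a.2 + c * (k.2 - a.2) + c' * (k'.2 - a.2)); first by rewrite /c /c'; ring.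
    by rewrite cz c'z; ring.
  have cp : 0 < c + c' by rewrite lt_neqAle eq_sym n0 addr_ge0.
  pose r := c / (c + c').
  have r01 : 0 <= r <= 1.
    by rewrite /r divr_ge0 ?addr_ge0//= ler_pdivrMr// mul1r; lra.
  have := PJ _ (1 - (c + c')) (cK k k' r r01 Kk Kk').
  have h : 0 <= 1 - (c + c') <= 1 by apply/andP; split; lra.
  move=> /(_ h) /=; congr (join_point a K _); congr pair; rewrite /r.
    have -> : 1 - c / (c + c') = c' / (c + c') by field.
    transitivity (a.1 * (1 - (c + c')) + (c * k.1 + c' * k'.1)); first by field.
    by rewrite /c /c'; ring.
  have -> : 1 - c / (c + c') = c' / (c + c') by field.
  transitivity (a.2 * (1 - (c + c')) + (c * k.2 + c' * k'.2)); first by field.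
  by rewrite /c /c'; ring.
Qed.

(** One more point replaces the hull by its join with that point, essentially a continuous image of
    a product with [0, 1]. Compactness is wanted for the measurability of lattice polygons. *)
Lemma compact_convex_hull_seq (s : seq (R * R)) :
  compact (convex_hull [set` s] : set (R^o * R^o)).
Proof.
elim: s => [|a s IH].
  rewrite (_ : convex_hull _ = set0); first exact: compact0.
  apply/seteqP; split => // x; apply: smallest_sub; last by move=> y; rewrite /= in_nil.
  by apply/convex_setP.
have cvs (t : seq (R * R)) : @convex_set R (R^o * R^o)%type (convex_hull [set` t]).
  apply/convex_setP => x y u u01 hx hy M [cM sM].
  have /convex_setP cM' := cM; apply: cM' => //; [exact: hx | exact: hy].
rewrite (_ : convex_hull _ = join_point a (convex_hull [set` s])).
  exact: compact_join_point.
apply/seteqP; split.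
  apply: smallest_sub; first exact: convex_join_point.
  move=> x /=; rewrite inE => /orP[/eqP->|xs]; first by left.
  have := @sub_gen_smallest _ (@convex_set R (R^o * R^o)%type) [set` s] x xs.
  move=> hx; right; exists (0, x) => /=; last first.
    by rewrite subr0 !mul0r !add0r !mul1r -surjective_pairing.
  by split => //=; rewrite in_itv/= lexx ler01.
have ha : convex_hull [set` a :: s] a.
  by apply: sub_gen_smallest => /=; rewrite mem_head.
have hs x : convex_hull [set` s] x -> convex_hull [set` a :: s] x.
  apply: smallest_sub; first exact: cvs.
  by move=> y ys; apply: sub_gen_smallest; rewrite /= inE ys orbT.
move=> x [->//|[[t y] /= [+ hy] <-]]; rewrite in_itv/= => t01.
have /convex_setP h := cvs (a :: s).
by apply: (h a y t t01) => //; exact: hs.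
Qed.
End PlaneConvexHull.

(** * Stable intersections and transversality *)

(** The cross product of the edges [u1 - u0] and [w1 - w0]. The ring is a parameter because
    non-parallelism is used over R and unimodularity over the integers. *)
Definition edge_det (A : comNzRingType) (u0 u1 w0 w1 : nat * nat) : A :=
  (u1.1%:R - u0.1%:R) * (w1.2%:R - w0.2%:R)
  - (u1.2%:R - u0.2%:R) * (w1.1%:R - w0.1%:R).

Definition exps (m : nat) : seq (nat * nat) :=
  [seq (i, j) | i <- iota 0 m.+1, j <- iota 0 (m - i).+1].

Arguments exps : simpl never.

Lemma mem_exps m u : (u \in exps m) = (u.1 + u.2 <= m)%N.
Proof.
apply/allpairsPdep/idP => [[i [j []]]|].
  by rewrite !mem_iota => hi hj ->; move: hi hj => /=; lia.
move=> h; exists u.1, u.2; rewrite !mem_iota -surjective_pairing; split=> //; lia.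
Qed.

Lemma uniq_exps m : uniq (exps m).
Proof.
apply: allpairs_uniq_dep; [exact: iota_uniq | by move=> *; exact: iota_uniq |].
by move=> [i j] [k l] _ _ /= [ik jl]; rewrite ik jl.
Qed.

Lemma size_exps m : (2 * size (exps m) = m.+1 * m.+2)%N.
Proof.
have -> : exps m = [seq (i, j) | i <- index_iota 0 m.+1, j <- iota 0 (m - i).+1].
  by rewrite /index_iota subn0.
rewrite size_allpairs_dep sumnE big_map.
rewrite big_nat_rev /= add0n.
rewrite (eq_big_nat _ _ (F2 := fun i => i.+1)); last first.
  by move=> i /andP[_ im]; rewrite size_iota subSS subKn.
elim: m => [|m IH]; first by rewrite big_nat1.
by rewrite big_nat_recr//= mulnDr IH; lia.
Qed.

(** A combinatorial substitute for positive multiplicity, which can be followed under perturbation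
    without measuring anything. *)
Definition crossing (R : realType) (d e : nat) (f g : nat -> nat -> R)
    (q : R * R) : Prop :=
  exists u0 u1 w0 w1,
    [/\ maximal_exponents d f q u0, maximal_exponents d f q u1,
        maximal_exponents e g q w0, maximal_exponents e g q w1
      & edge_det R u0 u1 w0 w1 != 0].

Lemma seq_argmax (R : realDomainType) (I : eqType) (s : seq I) (F : I -> R) i0 :
  i0 \in s -> exists2 i, i \in s & forall k, k \in s -> F k <= F i.
Proof.
elim: s i0 => // j [|j' s] IH i0 _.
  by exists j; rewrite ?mem_head// => k; rewrite inE => /eqP ->.
have [i si imax] := IH j' (mem_head _ _).
have [h|h] := lerP (F j) (F i).
  exists i; first by rewrite in_cons si orbT.
  by move=> k; rewrite inE => /orP[/eqP->|/imax].
exists j; rewrite ?mem_head// => k; rewrite inE => /orP[/eqP->//|/imax].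
by move=> /le_trans; apply; exact: ltW.
Qed.

Lemma maximal_exponents_ex (R : realType) m (a : nat -> nat -> R) q :
  exists u, maximal_exponents m a q u.
Proof.
have m0 : (0, 0)%N \in exps m by rewrite mem_exps.
have [u um umax] := seq_argmax (tropical_monomial a ^~ q) m0.
exists u; split; first by rewrite /exponents /= -mem_exps.
by move=> w wm; apply: umax; rewrite mem_exps.
Qed.

(** * Nonzero mixed area forces a crossing *)

Section MixedArea.
Variable R : realType.
Implicit Types (P Q : set (R * R)) (S : set (nat * nat)).

Lemma lattice_polygon_line S (n1 n2 c : R) :
  (forall u, S u -> n1 * u.1%:R + n2 * u.2%:R = c) ->
  forall x, @lattice_polygon R S x -> n1 * x.1 + n2 * x.2 = c.
Proof.
move=> h; apply: smallest_sub; first exact: convex_line.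
by move=> _ [u /h hu <-].
Qed.

Lemma measurable_lattice_polygon m S : S `<=` exponents m ->
  measurable (@lattice_polygon R S).
Proof.
move=> Sm; apply: compact_measurable_plane; rewrite /lattice_polygon.
pose s := [seq (u.1%:R : R, u.2%:R : R) | u <- [seq u <- exps m | `[< S u >]]].
have -> : [set (u.1%:R : R, u.2%:R : R) | u in S] = [set` s].
  apply/seteqP; split => x.
    move=> [u Su <-] /=; apply: map_f; rewrite mem_filter mem_exps.
    by rewrite (Sm _ Su) andbT; apply/asboolP.
  move=> /= /mapP[u]; rewrite mem_filter => /andP[/asboolP Su _] ->.
  by exists u.
exact: compact_convex_hull_seq.
Qed.

Lemma mixed_area_point_l (a : R * R) Q :
  measurable Q -> mixed_area [set a] Q = 0.
Proof.
move=> mQ; rewrite /mixed_area.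
have -> : minkowski_sum [set a] Q = [set (a.1 + y.1, a.2 + y.2) | y in Q].
  apply/seteqP; split => x.
    by move=> [_ -> [y Qy <-]]; exists y.
  by move=> [y Qy <-]; exists a => //; exists y.
have a0 : area [set a] = 0.
  by apply: (@area_line_eq0 _ 1 0 a.1); [rewrite oner_eq0 | move=> x ->; ring].
by rewrite area_translation// a0; ring.
Qed.

Lemma mixed_areaC P Q : mixed_area P Q = mixed_area Q P.
Proof.
rewrite /mixed_area.
have -> : minkowski_sum P Q = minkowski_sum Q P.
  apply/seteqP; split => _ [x xP [y yQ <-]]; exists y => //; exists x => //;
    by congr pair; rewrite addrC.
by ring.
Qed.

Lemma mixed_area_lines P Q (n1 n2 c c' : R) : (n1 != 0) || (n2 != 0) ->
  (forall x, P x -> n1 * x.1 + n2 * x.2 = c) ->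
  (forall x, Q x -> n1 * x.1 + n2 * x.2 = c') -> mixed_area P Q = 0.
Proof.
move=> n0 hP hQ; rewrite /mixed_area (area_line_eq0 n0 hP) (area_line_eq0 n0 hQ).
rewrite (@area_line_eq0 _ n1 n2 (c + c')) ?subr0// => _ [x /hP hx [y /hQ hy <-]] /=.
by rewrite -hx -hy; ring.
Qed.

Lemma lattice_polygon1 u : @lattice_polygon R [set u] = [set (u.1%:R, u.2%:R)].
Proof. by rewrite /lattice_polygon image_set1 convex_hull_set1. Qed.

(** Without a crossing, either one polygon is a point, and the sum is a translate of the other, or
    both lie on parallel lines and all three areas vanish. *)
Lemma stable_intersection_crossing (T : set R) d e f g q :
  stable_intersection T d e f g q != 0 ->
  (T `*` T) q /\ crossing d e f g q.
Proof.
rewrite /stable_intersection; case: ifPn => [|_]; last by rewrite eqxx.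
rewrite inE => qT M0; split => //; apply: contrapT => ncr.
move/eqP: M0; apply.
set P := maximal_exponents d f q; set Q := maximal_exponents e g q.
have sP : P `<=` exponents d by move=> u [].
have sQ : Q `<=` exponents e by move=> u [].
have [u0 Pu0] := maximal_exponents_ex d f q.
have [w0 Qw0] := maximal_exponents_ex e g q.
have [[u1 [Pu1 u10]]|nP] := pselect (exists u1, P u1 /\ u1 <> u0); last first.
  have -> : P = [set u0].
    apply/seteqP; split => [u Pu|_ ->//]; apply: contrapT => uu0.
    by apply: nP; exists u.
  rewrite lattice_polygon1 mixed_area_point_l//.
  exact: measurable_lattice_polygon sQ.
have [[w1 [Qw1 w10]]|nQ] := pselect (exists w1, Q w1 /\ w1 <> w0); last first.
  have -> : Q = [set w0].
    apply/seteqP; split => [w Qw|_ ->//]; apply: contrapT => ww0.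
    by apply: nQ; exists w.
  rewrite lattice_polygon1 mixed_areaC mixed_area_point_l//.
  exact: measurable_lattice_polygon sP.
(* A common normal of the two lines: the edge from [w0] to [w1] turned by a right angle. *)
pose n1 : R := w1.2%:R - w0.2%:R.
pose n2 : R := - (w1.1%:R - w0.1%:R).
have n0 : (n1 != 0) || (n2 != 0).
  rewrite oppr_eq0 !subr_eq0 !eqr_nat -negb_and; apply/negP => /andP[/eqP h1 /eqP h2].
  by apply: w10; case: (w0) (w1) h1 h2 => ? ? [? ?] /= -> ->.
have det0 u u' w w' : P u -> P u' -> Q w -> Q w' -> edge_det R u u' w w' = 0.
  move=> Pu Pu' Qw Qw'; apply: contrapT => /eqP h; apply: ncr.
  by exists u, u', w, w'.
have PL : forall u, P u -> n1 * u.1%:R + n2 * u.2%:R = n1 * u0.1%:R + n2 * u0.2%:R.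
  move=> u Pu; have := det0 _ _ _ _ Pu0 Pu Qw0 Qw1; rewrite /edge_det /n1 /n2.
  by move=> h; apply/eqP; rewrite -subr_eq0 -h; apply/eqP; ring.
have QL : forall w, Q w -> n1 * w.1%:R + n2 * w.2%:R = n1 * w0.1%:R + n2 * w0.2%:R.
  move=> w Qw; have := det0 _ _ _ _ Pu0 Pu1 Qw0 Qw.
  have := det0 _ _ _ _ Pu0 Pu1 Qw0 Qw1; rewrite /edge_det /n1 /n2.
  set a1 : R := u1.1%:R - _; set a2 : R := u1.2%:R - _.
  move=> h1 h2; apply/eqP; rewrite -subr_eq0; apply/eqP.
  have a0 : (a1 != 0) || (a2 != 0).
    rewrite !subr_eq0 !eqr_nat -negb_and; apply/negP => /andP[/eqP k1 /eqP k2].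
    by apply: u10; case: (u0) (u1) k1 k2 => ? ? [? ?] /= -> ->.
  case/orP: a0 => a0; apply: (mulfI a0); rewrite mulr0.
    transitivity ((w.1%:R - w0.1%:R) * (a1 * (w1.2%:R - w0.2%:R) - a2 * (w1.1%:R - w0.1%:R))
      - (w1.1%:R - w0.1%:R) * (a1 * (w.2%:R - w0.2%:R) - a2 * (w.1%:R - w0.1%:R))); first by ring.
    by rewrite h1 h2 !mulr0 subr0.
  transitivity ((w.2%:R - w0.2%:R) * (a1 * (w1.2%:R - w0.2%:R) - a2 * (w1.1%:R - w0.1%:R))
      - (w1.2%:R - w0.2%:R) * (a1 * (w.2%:R - w0.2%:R) - a2 * (w.1%:R - w0.1%:R))); first by ring.
  by rewrite h1 h2 !mulr0 subr0.
apply: (mixed_area_lines n0).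
  exact: (lattice_polygon_line PL).
exact: (lattice_polygon_line QL).
Qed.

End MixedArea.

(** * Crossings under a small translation *)

Section FirstExit.
Variable R : realType.

(** The ratio test: [al] is the initial slack of a constraint and [be] the rate at which it shrinks
    along a ray. The constraint met first maximizes [be / al]; [i0] makes this maximum positive, so
    that the ray does leave. *)
Lemma first_exit (I : eqType) (s : seq I) (al be : I -> R) i0 :
  (forall i, i \in s -> 0 < al i) -> i0 \in s -> 0 < be i0 ->
  exists2 t, 0 < t & exists2 i, i \in s &
    al i = t * be i /\ forall k, k \in s -> t * be k <= al k.
Proof.
move=> al0 i0s be0.
have [i si imax] := seq_argmax (fun k => be k / al k) i0s.
have r0 : 0 < be i / al i.
  by apply: lt_le_trans (imax _ i0s); rewrite divr_gt0// al0.
exists (be i / al i)^-1; first by rewrite invr_gt0.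
have ai := al0 _ si.
exists i => //; split.
  have bi : be i != 0 by apply: contraTneq r0 => ->; rewrite mul0r ltxx.
  by rewrite invf_div mulfVK.
by move=> k ks; rewrite mulrC ler_pdivrMr// mulrC -ler_pdivrMr ?al0// imax.
Qed.

End FirstExit.

Section Translation.
Variable R : realType.
Implicit Types (f g a : nat -> nat -> R) (q x y v : R * R) (u w : nat * nat).

Definition dot u x : R := u.1%:R * x.1 + u.2%:R * x.2.

Definition translate a v : nat -> nat -> R :=
  fun i j => a i j - (i%:R * v.1 + j%:R * v.2).

Definition two_maximal m a q : Prop :=
  exists u0 u1, [/\ maximal_exponents m a q u0, maximal_exponents m a q u1
                   & u0 != u1].

Lemma maximal_exponents_translate m a v q u :
  maximal_exponents m (translate a v) (q.1 + v.1, q.2 + v.2) u <->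
  maximal_exponents m a q u.
Proof.
have monE w : tropical_monomial (translate a v) w (q.1 + v.1, q.2 + v.2) =
    tropical_monomial a w q by rewrite /tropical_monomial /translate /=; ring.
by split=> -[um umax]; split=> // w wm; move: (umax w wm); rewrite !monE.
Qed.

Lemma near_seq (I : eqType) (s : seq I) (P : I -> R -> Prop) :
  (forall i, i \in s -> \forall e \near 0^'+, P i e) ->
  \forall e \near 0^'+, forall i, i \in s -> P i e.
Proof.
elim: s => [|j s IH] sP; first by near=> e.
have h1 := sP j (mem_head _ _).
have h2 : \forall e \near 0^'+, forall i, i \in s -> P i e.
  by apply: IH => i si; apply: sP; rewrite inE si orbT.
near=> e => i; rewrite inE => /orP[/eqP ->|].
  by near: e.
by move: i; near: e.
Unshelve. all: by end_near. Qed.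

(** Each degenerate coincidence will determine the translation parameter, so this is the form in
    which it is excluded for all small parameters. *)
Lemma near_avoid (B : R -> Prop) :
  (forall e e', B e -> B e' -> e = e') -> \forall e \near 0^'+, ~ B e.
Proof.
move=> uB; have [[b [b0 Bb]]|nB] := pselect (exists b, 0 < b /\ B b).
  near=> e => Be; have : e < b by near: e; exact: nbhs_right_lt.
  by rewrite (uB _ _ Be Bb) ltxx.
near=> e => Be; apply: nB; exists e; split=> //.
Unshelve. all: by end_near. Qed.

(** After a small step only the exponents tied with [u] at [q] compete, and among them the linear
    part in the direction [y] decides; all others stay behind by a positive gap. *)
Lemma maximal_exponents_near m a q y u :
  maximal_exponents m a q u ->
  (forall w, maximal_exponents m a q w -> dot w y <= dot u y) ->
  \forall e \near 0^'+, maximal_exponents m a (q.1 + e * y.1, q.2 + e * y.2) u.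
Proof.
move=> [um umax] uy.
have monE w e : tropical_monomial a w (q.1 + e * y.1, q.2 + e * y.2) =
    tropical_monomial a w q + e * dot w y.
  by rewrite /tropical_monomial /dot /=; ring.
have : \forall e \near 0^'+, forall w, w \in exps m ->
    tropical_monomial a w q + e * dot w y <= tropical_monomial a u q + e * dot u y.
  apply: near_seq => w; rewrite mem_exps => wm.
  have := umax w wm; rewrite le_eqVlt => /orP[/eqP wu|wu].
    have wmax : maximal_exponents m a q w.
      by split=> // w' w'm; rewrite wu; exact: umax.
    near=> e; have e0 : 0 < e by near: e; exact: nbhs_right_gt.
    by rewrite wu lerD2l ler_pM2l// uy.
  have [h|h] := lerP (dot w y) (dot u y).
    near=> e; have e0 : 0 < e by near: e; exact: nbhs_right_gt.
    by apply: lerD; [exact: ltW | rewrite ler_pM2l].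
  near=> e.
  have : e < (tropical_monomial a u q - tropical_monomial a w q) / (dot w y - dot u y).
    by near: e; apply: nbhs_right_lt; rewrite divr_gt0// subr_gt0.
  by rewrite ltr_pdivlMr ?subr_gt0// mulrBr; lra.
apply: filterS => e h; split=> // w wm; rewrite !monE; apply: h.
by rewrite mem_exps.
Unshelve. all: by end_near. Qed.

(** The infinitesimal picture at a crossing: the fan of [P] and the fan of [Q] moved by [v] still
    meet. If [v] is not already on the fan of [P], it lies in the open cell of some [us]; follow
    from [v] a ray [x] of the fan of [Q] along which [us] loses to some [u'], until that cell is
    left. *)
Lemma dual_cones_meet (P Q : seq (nat * nat)) u0 u1 w0 w1 v :
  u0 \in P -> u1 \in P -> w0 \in Q -> w1 \in Q -> edge_det R u0 u1 w0 w1 != 0 ->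
  exists y, (exists u u', [/\ u \in P, u' \in P, u != u',
      forall k, k \in P -> dot k y <= dot u y & dot u y = dot u' y]) /\
    (exists w w', [/\ w \in Q, w' \in Q, w != w',
      forall k, k \in Q -> dot k (y.1 - v.1, y.2 - v.2) <= dot w (y.1 - v.1, y.2 - v.2)
      & dot w (y.1 - v.1, y.2 - v.2) = dot w' (y.1 - v.1, y.2 - v.2)]).
Proof.
move=> u0P u1P w0Q w1Q det0.
have w01 : w0 != w1.
  by apply: contraNneq det0 => ->; rewrite /edge_det !subrr !mulr0 subrr.
have [us usP usmax] := seq_argmax (dot^~ v) u0P.
have [[u' [u'P u'us u'tie]]|notie] := pselect (exists u', [/\ u' \in P, us != u' & dot us v = dot u' v]).
  exists v; split; first by exists us, u'.
  exists w0, w1; rewrite !subrr /dot /=; split => //; last by ring.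
  by move=> k _; rewrite !mulr0.
have strict k : k \in P -> k != us -> 0 < dot us v - dot k v.
  move=> kP kus; rewrite subr_gt0 lt_neqAle usmax// andbT.
  by apply/eqP => h; apply: notie; exists k; split => //; rewrite eq_sym.
(* The edges from [us] to [u0] and [u1] cannot both be parallel to that from [w0] to [w1], since
   their difference is not. *)
have [u' u'P detu'] : exists2 u', u' \in P & edge_det R u' us w0 w1 != 0.
  have [h|h] := eqVneq (edge_det R u0 us w0 w1) 0; last by exists u0.
  exists u1 => //; apply: contraNneq det0 => h1.
  rewrite -[0]subr0 -{1}h -h1 /edge_det; apply/eqP; ring.
have u'us : u' != us.
  by apply: contraNneq detu' => ->; rewrite /edge_det !subrr !mul0r subrr.
pose n : R * R := (us.1%:R - u'.1%:R, us.2%:R - u'.2%:R).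
have n0 : 0 < n.1 * n.1 + n.2 * n.2.
  rewrite -!expr2 lt_neqAle addr_ge0 ?sqr_ge0// andbT eq_sym.
  rewrite paddr_eq0 ?sqr_ge0// !expf_eq0 /=; apply: contraNN detu'.
  by rewrite /edge_det -/(n.1) -/(n.2) => /andP[/eqP -> /eqP ->]; rewrite !mul0r subrr.
have dotn x : dot us x - dot u' x = n.1 * x.1 + n.2 * x.2.
  by rewrite /dot /n /=; ring.
have [x [[w [w' [wQ w'Q ww' wmax wtie]]] nx]] : exists x,
    (exists w w', [/\ w \in Q, w' \in Q, w != w',
      forall k, k \in Q -> dot k x <= dot w x & dot w x = dot w' x]) /\
    dot us x - dot u' x < 0.
  pose x0 : R * R := (- n.1, - n.2).
  have [ws wsQ wsmax] := seq_argmax (dot^~ x0) w0Q.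
  have [[w' [w'Q w'ws w'tie]]|wnotie] := pselect (exists w', [/\ w' \in Q, ws != w' & dot ws x0 = dot w' x0]).
    exists x0; split; first by exists ws, w'.
    by rewrite dotn; move: n0; rewrite /x0 /=; lra.
  have wstrict k : k \in Q -> k != ws -> 0 < dot ws x0 - dot k x0.
    move=> kP kus; rewrite subr_gt0 lt_neqAle wsmax// andbT.
    by apply/eqP => h; apply: wnotie; exists k; split => //; rewrite eq_sym.
  have [w wQ detw] : exists2 w, w \in Q & edge_det R u' us ws w != 0.
    have [h|h] := eqVneq (edge_det R u' us ws w0) 0; last by exists w0.
    exists w1 => //; apply: contraNneq detu' => h1.
    rewrite -[0]subr0 -{1}h1 -h /edge_det; apply/eqP; ring.
  have wws : w != ws.
    by apply: contraNneq detw => ->; rewrite /edge_det !subrr !mulr0 subrr.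
  pose D := edge_det R u' us ws w.
  (* Orthogonal to [n], so that the comparison of [us] with [u'] is unchanged along it, and signed
     so that [w] gains on [ws] at the rate [D ^+ 2]. *)
  pose x1 : R * R := (- D * n.2, D * n.1).
  have dotx1 : dot w x1 - dot ws x1 = D ^+ 2.
    by rewrite /x1 /D /n /dot /edge_det /=; ring.
  have D2 : 0 < D ^+ 2 by rewrite lt_neqAle sqr_ge0 andbT eq_sym expf_eq0.
  have wIn : w \in [seq k <- Q | k != ws] by rewrite mem_filter wws.
  have al0 k : k \in [seq k <- Q | k != ws] -> 0 < dot ws x0 - dot k x0.
    by rewrite mem_filter => /andP[? ?]; exact: wstrict.
  have [|t t0 [k]] := @first_exit R _ _ (fun k => dot ws x0 - dot k x0)
    (fun k => dot k x1 - dot ws x1) w al0 wIn; first by rewrite dotx1.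
  rewrite mem_filter => /andP[kws kQ] [ktie kmax].
  pose x : R * R := (x0.1 + t * x1.1, x0.2 + t * x1.2).
  have dotx m : dot m x = dot m x0 + t * dot m x1 by rewrite /x /dot /=; ring.
  exists x; split; last by rewrite dotn; move: n0; rewrite /x /x0 /x1 /=; lra.
  exists ws, k; split => //; first by rewrite eq_sym.
    move=> m mQ; have [->//|mws] := eqVneq m ws.
    have := kmax m; rewrite mem_filter mws => /(_ mQ); rewrite !dotx; lra.
  by rewrite !dotx; lra.
have u'In : u' \in [seq k <- P | k != us] by rewrite mem_filter u'us.
have al0 k : k \in [seq k <- P | k != us] -> 0 < dot us v - dot k v.
  by rewrite mem_filter => /andP[? ?]; exact: strict.
(* The fan of [Q] is a cone, so every point [v + t x] remains on its translate; only the exit from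
   the cell of [us] is left to find. *)
have [|t t0 [k]] := @first_exit R _ _ (fun k => dot us v - dot k v)
  (fun k => dot k x - dot us x) u' al0 u'In; first by lra.
rewrite mem_filter => /andP[kus kP] [ktie kmax].
pose y : R * R := (v.1 + t * x.1, v.2 + t * x.2).
have doty m : dot m y = dot m v + t * dot m x by rewrite /y /dot /=; ring.
have dotyv m : dot m (y.1 - v.1, y.2 - v.2) = t * dot m x by rewrite /y /dot /=; ring.
exists y; split.
  exists us, k; split => //; first by rewrite eq_sym.
    move=> m mP; have [->//|mus] := eqVneq m us.
    have := kmax m; rewrite mem_filter mus => /(_ mP); rewrite !doty; lra.
  by rewrite !doty; lra.
exists w, w'; split => //; last by rewrite !dotyv wtie.
by move=> m mQ; rewrite !dotyv ler_pM2l// wmax.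
Qed.

(** Near [q] both curves coincide with fans, so translating by [t v] scales the picture of
    [dual_cones_meet] by t and the new common point is [q + t y]. That its edges are not parallel
    will come from transversality. *)
Lemma crossing_persists d e f g q v (eta : R) : 0 < eta ->
  crossing d e f g q ->
  \forall t \near 0^'+, exists q', [/\ `|q'.1 - q.1| < eta, `|q'.2 - q.2| < eta,
    two_maximal d f q' & two_maximal e (translate g (t * v.1, t * v.2)) q'].
Proof.
move=> eta0 [u0 [u1 [w0 [w1 [Pu0 Pu1 Qw0 Qw1 det0]]]]].
pose P := [seq u <- exps d | `[< maximal_exponents d f q u >]].
pose Q := [seq w <- exps e | `[< maximal_exponents e g q w >]].
have inP u : maximal_exponents d f q u <-> u \in P.
  rewrite mem_filter mem_exps; split; last by case/andP => /asboolP.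
  by move=> h; rewrite asboolT//=; have [] := h.
have inQ w : maximal_exponents e g q w <-> w \in Q.
  rewrite mem_filter mem_exps; split; last by case/andP => /asboolP.
  by move=> h; rewrite asboolT//=; have [] := h.
move/inP: Pu0 => Pu0; move/inP: Pu1 => Pu1; move/inQ: Qw0 => Qw0; move/inQ: Qw1 => Qw1.
have [y [[u [u' [/inP uP /inP u'P uu' umax utie]]] [w [w' [/inQ wQ /inQ w'Q ww' wmax wtie]]]]] :=
  dual_cones_meet v Pu0 Pu1 Qw0 Qw1 det0.
pose z : R * R := (y.1 - v.1, y.2 - v.2).
have nearu k : maximal_exponents d f q k -> dot k y = dot u y ->
    \forall t \near 0^'+, maximal_exponents d f (q.1 + t * y.1, q.2 + t * y.2) k.
  by move=> kP ku; apply: maximal_exponents_near => // m /inP/umax; rewrite ku.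
have nearw k : maximal_exponents e g q k -> dot k z = dot w z ->
    \forall t \near 0^'+, maximal_exponents e g (q.1 + t * z.1, q.2 + t * z.2) k.
  by move=> kQ kw; apply: maximal_exponents_near => // m /inQ/wmax; rewrite kw.
have small (c : R) : \forall t \near 0^'+, `|t * c| < eta.
  near=> t; have t0 : 0 < t by near: t; exact: nbhs_right_gt.
  have : t < eta / (`|c| + 1).
    by near: t; apply: nbhs_right_lt; rewrite divr_gt0// ltr_wpDl.
  rewrite ltr_pdivlMr ?ltr_wpDl// normrM gtr0_norm//; nra.
near=> t.
exists (q.1 + t * y.1, q.2 + t * y.2); split => /=.
- by rewrite addrAC subrr add0r; near: t; exact: small.
- by rewrite addrAC subrr add0r; near: t; exact: small.
- exists u, u'; split => //; near: t; first exact: nearu.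
  by apply: nearu => //; exact: esym.
- have -> : (q.1 + t * y.1, q.2 + t * y.2) =
    ((q.1 + t * z.1, q.2 + t * z.2).1 + (t * v.1, t * v.2).1,
     (q.1 + t * z.1, q.2 + t * z.2).2 + (t * v.1, t * v.2).2).
    by rewrite /z /=; congr pair; ring.
  exists w, w'; split => //; apply/maximal_exponents_translate; near: t.
    exact: nearw.
  by apply: nearw => //; exact: esym.
Unshelve. all: by end_near. Qed.

End Translation.

(** * Transversality of a generic translate *)

Section Transversality.
Variable R : realType.
Implicit Types (f g : nat -> nat -> R) (x y : R * R) (u w : nat * nat).

(** The first field excludes common points on parallel edges. In the other two, three exponents that
    are not collinear mark a vertex of one curve, which must not lie on the other. *)
Record transversal d e f g : Prop := Transversal {
  transversal_det : forall x u0 u1 w0 w1,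
    maximal_exponents d f x u0 -> maximal_exponents d f x u1 -> u0 != u1 ->
    maximal_exponents e g x w0 -> maximal_exponents e g x w1 -> w0 != w1 ->
    edge_det R u0 u1 w0 w1 != 0;
  transversal_l : forall x u0 u1 u2 w0 w1,
    maximal_exponents d f x u0 -> maximal_exponents d f x u1 ->
    maximal_exponents d f x u2 -> edge_det R u0 u1 u0 u2 != 0 ->
    maximal_exponents e g x w0 -> maximal_exponents e g x w1 -> w0 = w1;
  transversal_r : forall x w0 w1 w2 u0 u1,
    maximal_exponents e g x w0 -> maximal_exponents e g x w1 ->
    maximal_exponents e g x w2 -> edge_det R w0 w1 w0 w2 != 0 ->
    maximal_exponents d f x u0 -> maximal_exponents d f x u1 -> u0 = u1 }.

Lemma maximal_exponents_tie m f x u0 u1 :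
  maximal_exponents m f x u0 -> maximal_exponents m f x u1 ->
  tropical_monomial f u0 x = tropical_monomial f u1 x.
Proof.
by move=> [m0 h0] [m1 h1]; apply/eqP; rewrite eq_le h0// h1.
Qed.

Lemma parallel_dot_eq0 (a1 a2 b1 b2 y1 y2 : R) : a1 * b2 - a2 * b1 = 0 ->
  (a1 != 0) || (a2 != 0) -> a1 * y1 + a2 * y2 = 0 -> b1 * y1 + b2 * y2 = 0.
Proof.
move=> ab a0 ay; case/orP: a0 => a0; apply: (mulfI a0); rewrite mulr0.
  transitivity (b1 * (a1 * y1 + a2 * y2) + y2 * (a1 * b2 - a2 * b1)); first by ring.
  by rewrite ab ay !mulr0 addr0.
transitivity (b2 * (a1 * y1 + a2 * y2) - y1 * (a1 * b2 - a2 * b1)); first by ring.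
by rewrite ab ay !mulr0 subr0.
Qed.

Lemma independent_dot_eq0 (a1 a2 b1 b2 y1 y2 : R) : a1 * b2 - a2 * b1 != 0 ->
  a1 * y1 + a2 * y2 = 0 -> b1 * y1 + b2 * y2 = 0 -> y1 = 0 /\ y2 = 0.
Proof.
move=> ab ay byy; split; apply: (mulfI ab); rewrite mulr0.
  transitivity (b2 * (a1 * y1 + a2 * y2) - a2 * (b1 * y1 + b2 * y2)); first by ring.
  by rewrite ay byy !mulr0 subr0.
transitivity (a1 * (b1 * y1 + b2 * y2) - b1 * (a1 * y1 + a2 * y2)); first by ring.
by rewrite ay byy !mulr0 subr0.
Qed.

Lemma exponent_neq_coord u0 u1 : u0 != u1 ->
  (u1.1%:R - u0.1%:R != 0 :> R) || (u1.2%:R - u0.2%:R != 0 :> R).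
Proof.
rewrite !subr_eq0 !eqr_nat -negb_and; apply: contraNN => /andP[/eqP h1 /eqP h2].
by case: u0 u1 h1 h2 => ? ? [? ?] /= -> ->.
Qed.

(* The direction (1, N) is orthogonal to no difference of two exponents. *)
Lemma exponent_diff_steep m N u0 u1 : (m < N)%N -> (u0.1 + u0.2 <= m)%N ->
  (u1.1 + u1.2 <= m)%N -> u0 != u1 ->
  (u1.1%:R - u0.1%:R) * 1 + (u1.2%:R - u0.2%:R) * N%:R != 0 :> R.
Proof.
move=> mN h0 h1; apply: contraNneq => h.
have /eqP : (u1.1 + u1.2 * N)%:R = (u0.1 + u0.2 * N)%:R :> R.
  rewrite !natrD !natrM; lra.
rewrite eqr_nat => /eqP e.
have l0 : (u0.1 < N)%N by lia.
have l1 : (u1.1 < N)%N by lia.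
have e1 : u1.1 = u0.1.
  by have := congr1 (modn^~ N) e; rewrite /= ![(_ + _ * N)%N]addnC !modnMDl !modn_small.
have e2 : u1.2 = u0.2.
  by apply/eqP; rewrite -(eqn_pmul2r (leq_ltn_trans (leq0n m) mN)); apply/eqP; lia.
by apply/eqP; rewrite [u0]surjective_pairing [u1]surjective_pairing e1 e2.
Qed.

(** For each choice of exponents a degeneracy is an affine equation in t, whose leading coefficient
    is the scalar product of (1, N) with a difference of exponents. It is nonzero because N exceeds
    both degrees, so finitely many values of t are bad. *)
Lemma near_transversal d e f g (N := (d + e).+1) :
  \forall t \near 0^'+, transversal d e f (translate g (t * 1, t * N%:R)).
Proof.
have dN : (d < N)%N by rewrite /N; lia.
have eN : (e < N)%N by rewrite /N; lia.
pose G t := translate g (t * 1, t * N%:R).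
pose tie a u0 u1 x := tropical_monomial a u0 x = tropical_monomial a u1 x.
(* Parallel edges: the common points for two parameters differ by a vector along the edge of f,
   hence along that of g, which forces equal parameters. *)
have n1 : \forall t \near 0^'+, forall u0, u0 \in exps d -> forall u1, u1 \in exps d ->
    forall w0, w0 \in exps e -> forall w1, w1 \in exps e ->
    ~ (u0 != u1 /\ w0 != w1 /\ edge_det R u0 u1 w0 w1 = 0 /\
       exists x, tie f u0 u1 x /\ tie (G t) w0 w1 x).
  apply: near_seq => u0 _; apply: near_seq => u1 _.
  apply: near_seq => w0; rewrite mem_exps => hw0; apply: near_seq => w1.
  rewrite mem_exps => hw1; apply: near_avoid => t t'.
  move=> [u01 [w01 [det0 [x [fx gx]]]]] [_ [_ [_ [x' [fx' gx']]]]].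
  have h1 : (u1.1%:R - u0.1%:R) * (x.1 - x'.1) + (u1.2%:R - u0.2%:R) * (x.2 - x'.2) = 0.
    by move: fx fx'; rewrite /tie /tropical_monomial; lra.
  have := parallel_dot_eq0 det0 (exponent_neq_coord u01) h1.
  have := exponent_diff_steep eN hw0 hw1 w01.
  set b1 := w1.1%:R - w0.1%:R; set b2 := w1.2%:R - w0.2%:R => b0 bx.
  apply/eqP; rewrite -subr_eq0; apply/eqP; apply: (mulIf b0); rewrite mul0r.
  rewrite -bx; move: gx gx'.
  by rewrite /tie /tropical_monomial /G /translate /= /b1 /b2; nra.
have n2 : \forall t \near 0^'+, forall u0, u0 \in exps d -> forall u1, u1 \in exps d ->
    forall u2, u2 \in exps d ->
    forall w0, w0 \in exps e -> forall w1, w1 \in exps e ->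
    ~ (w0 != w1 /\ edge_det R u0 u1 u0 u2 != 0 /\
       exists x, [/\ tie f u0 u1 x, tie f u0 u2 x & tie (G t) w0 w1 x]).
  apply: near_seq => u0 _; apply: near_seq => u1 _; apply: near_seq => u2 _.
  apply: near_seq => w0; rewrite mem_exps => hw0; apply: near_seq => w1.
  rewrite mem_exps => hw1; apply: near_avoid => t t'.
  move=> [w01 [det0 [x [fx fx2 gx]]]] [_ [_ [x' [fx' fx2' gx']]]].
  have h1 : (u1.1%:R - u0.1%:R) * (x.1 - x'.1) + (u1.2%:R - u0.2%:R) * (x.2 - x'.2) = 0.
    by move: fx fx'; rewrite /tie /tropical_monomial; lra.
  have h2 : (u2.1%:R - u0.1%:R) * (x.1 - x'.1) + (u2.2%:R - u0.2%:R) * (x.2 - x'.2) = 0.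
    by move: fx2 fx2'; rewrite /tie /tropical_monomial; lra.
  have [y1 y2] := independent_dot_eq0 det0 h1 h2.
  have := exponent_diff_steep eN hw0 hw1 w01.
  set b1 := w1.1%:R - w0.1%:R; set b2 := w1.2%:R - w0.2%:R => b0.
  apply/eqP; rewrite -subr_eq0; apply/eqP; apply: (mulIf b0); rewrite mul0r.
  have <- : b1 * (x.1 - x'.1) + b2 * (x.2 - x'.2) = 0 by rewrite y1 y2; ring.
  move: gx gx'.
  by rewrite /tie /tropical_monomial /G /translate /= /b1 /b2; nra.
have n3 : \forall t \near 0^'+, forall w0, w0 \in exps e -> forall w1, w1 \in exps e ->
    forall w2, w2 \in exps e ->
    forall u0, u0 \in exps d -> forall u1, u1 \in exps d ->
    ~ (u0 != u1 /\ edge_det R w0 w1 w0 w2 != 0 /\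
       exists x, [/\ tie (G t) w0 w1 x, tie (G t) w0 w2 x & tie f u0 u1 x]).
  apply: near_seq => w0 _; apply: near_seq => w1 _; apply: near_seq => w2 _.
  apply: near_seq => u0; rewrite mem_exps => hu0; apply: near_seq => u1.
  rewrite mem_exps => hu1; apply: near_avoid => t t'.
  move=> [u01 [det0 [x [gx gx2 fx]]]] [_ [_ [x' [gx' gx2' fx']]]].
  (* The displacement of the vertex of g minus that of the translation. It is orthogonal to two
     independent edges, so the vertex moves exactly with g. *)
  pose z1 := x.1 - x'.1 - (t - t') * 1; pose z2 := x.2 - x'.2 - (t - t') * N%:R.
  have h1 : (w1.1%:R - w0.1%:R) * z1 + (w1.2%:R - w0.2%:R) * z2 = 0.
    by move: gx gx'; rewrite /tie /tropical_monomial /G /translate /= /z1 /z2; nra.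
  have h2 : (w2.1%:R - w0.1%:R) * z1 + (w2.2%:R - w0.2%:R) * z2 = 0.
    by move: gx2 gx2'; rewrite /tie /tropical_monomial /G /translate /= /z1 /z2; nra.
  have [y1 y2] := independent_dot_eq0 det0 h1 h2.
  have := exponent_diff_steep dN hu0 hu1 u01.
  set b1 := u1.1%:R - u0.1%:R; set b2 := u1.2%:R - u0.2%:R => b0.
  apply/eqP; rewrite -subr_eq0; apply/eqP; apply: (mulIf b0); rewrite mul0r.
  have -> : (t - t') * (b1 * 1 + b2 * N%:R) =
      b1 * (x.1 - x'.1 - z1) + b2 * (x.2 - x'.2 - z2) by rewrite /z1 /z2; ring.
  rewrite y1 y2; move: fx fx'.
  by rewrite /tie /tropical_monomial /= /b1 /b2; lra.
have inE m a x u : maximal_exponents m a x u -> u \in exps m.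
  by move=> [um _]; rewrite mem_exps.
near=> t; split.
- move=> x u0 u1 w0 w1 P0 P1 u01 Q0 Q1 w01; apply/eqP => det0.
  have : forall u0, u0 \in exps d -> forall u1, u1 \in exps d ->
    forall w0, w0 \in exps e -> forall w1, w1 \in exps e ->
    ~ (u0 != u1 /\ w0 != w1 /\ edge_det R u0 u1 w0 w1 = 0 /\
       exists x, tie f u0 u1 x /\ tie (G t) w0 w1 x) by near: t.
  move=> /(_ _ (inE _ _ _ _ P0) _ (inE _ _ _ _ P1) _ (inE _ _ _ _ Q0) _ (inE _ _ _ _ Q1)).
  apply; split => //; split => //; split => //; exists x.
  by split; apply: maximal_exponents_tie; eassumption.
- move=> x u0 u1 u2 w0 w1 P0 P1 P2 det0 Q0 Q1; apply: contrapT => /eqP w01.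
  have : forall u0, u0 \in exps d -> forall u1, u1 \in exps d ->
    forall u2, u2 \in exps d ->
    forall w0, w0 \in exps e -> forall w1, w1 \in exps e ->
    ~ (w0 != w1 /\ edge_det R u0 u1 u0 u2 != 0 /\
       exists x, [/\ tie f u0 u1 x, tie f u0 u2 x & tie (G t) w0 w1 x]) by near: t.
  move=> /(_ _ (inE _ _ _ _ P0) _ (inE _ _ _ _ P1) _ (inE _ _ _ _ P2) _ (inE _ _ _ _ Q0) _ (inE _ _ _ _ Q1)).
  apply; split => //; split => //; exists x.
  by split; apply: maximal_exponents_tie; eassumption.
- move=> x w0 w1 w2 u0 u1 Q0 Q1 Q2 det0 P0 P1; apply: contrapT => /eqP u01.
  have : forall w0, w0 \in exps e -> forall w1, w1 \in exps e ->
    forall w2, w2 \in exps e ->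
    forall u0, u0 \in exps d -> forall u1, u1 \in exps d ->
    ~ (u0 != u1 /\ edge_det R w0 w1 w0 w2 != 0 /\
       exists x, [/\ tie (G t) w0 w1 x, tie (G t) w0 w2 x & tie f u0 u1 x]) by near: t.
  move=> /(_ _ (inE _ _ _ _ Q0) _ (inE _ _ _ _ Q1) _ (inE _ _ _ _ Q2) _ (inE _ _ _ _ P0) _ (inE _ _ _ _ P1)).
  apply; split => //; split => //; exists x.
  by split; apply: maximal_exponents_tie; eassumption.
Unshelve. all: by end_near. Qed.

End Transversality.

(** * Tropical linear algebra *)

Lemma finite_pos_lower_bound (R : realFieldType) (I : finType) (P : pred I)
    (F : I -> R) : (forall i, P i -> 0 < F i) ->
  exists2 c, 0 < c & forall i, P i -> c <= F i.
Proof.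
move=> F0; exists (\big[Order.min/1]_(i | P i) F i).
  by elim/big_ind: _ => // x y x0 y0; rewrite lt_min x0.
by move=> i Pi; rewrite (bigD1 i)//= ge_min lexx.
Qed.

Section TropicalMatrix.
Variables (R : realFieldType) (n : nat).
Implicit Types (A : 'I_n -> 'I_n -> R) (s t : {perm 'I_n}).

Definition perm_weight A s : R := \sum_i A i (s i).

Definition tropically_singular A : Prop :=
  exists s t, [/\ s != t, forall r, perm_weight A r <= perm_weight A s
                & forall r, perm_weight A r <= perm_weight A t].

(* Tropical Cramer rule: c j is the tropical minor obtained by deleting a row
   on which two optimal permutations differ, and the column j. *)
Lemma tropically_singular_kernel A (T : R -> Prop) :
  T 0 -> (forall x y, T x -> T y -> T (x + y)) -> (forall i j, T (A i j)) ->
  tropically_singular A ->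
  exists2 c : 'I_n -> R, forall j, T (c j) &
    forall i, exists j j', [/\ j != j', forall k, A i k + c k <= A i j + c j
                             & forall k, A i k + c k <= A i j' + c j'].
Proof.
move=> T0 TD TA [s [t [st smax tmax]]].
have [i0 sti0] : exists i0, s i0 != t i0.
  apply: contrapT => h; move/eqP: st; apply; apply/permP => i.
  by apply: contrapT => /eqP sti; apply: h; exists i.
pose W0 (p : {perm 'I_n}) := \sum_(i | i != i0) A i (p i).
have WE p : perm_weight A p = A i0 (p i0) + W0 p by rewrite /perm_weight (bigD1 i0).
(* A best assignment of the rows other than [i0] to the columns other than [j]; [tperm i0 j]
   witnesses that there is one. *)
pose P j := [arg max_(p > tperm i0 j | p i0 == j) W0 p]%O.
have PP j : P j i0 = j /\ forall p : {perm 'I_n}, p i0 = j -> W0 p <= W0 (P j).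
  rewrite /P; case: arg_maxP => [|p /eqP pj pmax]; first by rewrite tpermL.
  by split=> // p' /eqP; exact: pmax.
pose c j := W0 (P j).
exists c => [j|i]; first by rewrite /c /W0; elim/big_ind: _.
have [->|ii0] := eqVneq i i0.
  exists (s i0), (t i0); split => // k.
    rewrite (le_trans (y := perm_weight A s))//.
      by have := smax (P k); rewrite (WE (P k)) (PP k).1.
    by rewrite WE lerD2l (PP _).2.
  rewrite (le_trans (y := perm_weight A t))//.
    by have := tmax (P k); rewrite (WE (P k)) (PP k).1.
  by rewrite WE lerD2l (PP _).2.
pose j := [arg max_(k > i0) (A i k + c k)]%O.
have jmax k : A i k + c k <= A i j + c j.
  by rewrite /j; case: arg_maxP => // m _; exact.
have jE : P j i0 = j by exact: (PP j).1.
exists j, (P j i); split => //.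
  by rewrite -{1}jE (inj_eq perm_inj) eq_sym.
move=> k; rewrite (le_trans (jmax k))//.
(* Exchanging the columns of rows [i0] and [i] in [P j] gives a competitor for the minor of column
   [P j i], which therefore ties with [j] in row [i]. *)
pose p := (tperm i0 i * P j)%g.
have pi0 : p i0 = P j i by rewrite permM tpermL.
have pi : p i = j by rewrite permM tpermR.
have := (PP _).2 _ pi0; rewrite -(lerD2l (A i (P j i))); apply: le_trans.
rewrite /c /W0 (bigD1 i)//= [X in _ <= _ + X](bigD1 i)//= pi.
rewrite addrCA lerD2l lerD2l le_eqVlt; apply/orP; left; apply/eqP.
apply: eq_bigr => k' /andP[k1 k2]; congr A; rewrite permM tpermD// eq_sym//.
Qed.

(** In an optimal [s], the column of each row of [I] is served at least as well, after weighting by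
    [r], by another row of [I]. Passing columns on along a cycle of this choice cancels the weights
    and yields a second optimal permutation. *)
Lemma row_dependent_tropically_singular A (I : {set 'I_n}) (r : 'I_n -> R) :
  I != finset.set0 ->
  (forall j, exists i1 i2, [/\ i1 \in I, i2 \in I, i1 != i2,
     forall k, k \in I -> r k + A k j <= r i1 + A i1 j
   & forall k, k \in I -> r k + A k j <= r i2 + A i2 j]) ->
  tropically_singular A.
Proof.
move=> I0 dep.
pose s := [arg max_(p > (1%g : {perm 'I_n})) perm_weight A p]%O.
have smax p : perm_weight A p <= perm_weight A s.
  by rewrite /s; case: arg_maxP => // m _; exact.
have /choice[tau tauP] : forall i, exists x, i \in I ->
    [/\ x \in I, x != i & r i + A i (s i) <= r x + A x (s i)].
  move=> i.
  have [iI|_] := boolP (i \in I); last by exists i.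
  have [i1 [i2 [i1I i2I i12 h1 h2]]] := dep (s i).
  have [e|ne] := eqVneq i1 i; last by exists i1 => _; split => //; exact: h1.
  by exists i2 => _; split => //; [rewrite -e eq_sym | exact: h2].
(* The image of a stable set is stable, so on a stable set of least cardinality [tau] is injective:
   this is the cycle. *)
pose stable (C : {set 'I_n}) := [&& C != finset.set0, C \subset I & (tau @: C)%SET \subset C].
have stI : stable I.
  rewrite /stable I0 subxx /=; apply/fintype.subsetP => _ /imsetP[i iI ->].
  by have [] := tauP i iI.
pose C := [arg min_(C < I | stable C) #|C|].
have [/and3P[C0 CI tauC] Cmin] : stable C /\ forall D, stable D -> (#|C| <= #|D|)%N.
  by rewrite /C; case: arg_minnP.
have tauinj : {in C &, injective tau}.
  apply/imset_injP; rewrite eqn_leq leq_imset_card /=; apply: Cmin.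
  rewrite /stable (fintype.subset_trans tauC CI) imsetS// andbT andbT.
  have /set0Pn[x xC] := C0; apply/set0Pn; exists (tau x); exact: imset_f.
have tauCin i : i \in C -> tau i \in C.
  by move=> iC; apply: (fintype.subsetP tauC); exact: imset_f.
pose h i := if i \in C then tau i else i.
have hinj : injective h.
  move=> x y; rewrite /h; case: ifPn => xC; case: ifPn => yC //; first exact: tauinj.
    by move=> e; rewrite -e tauCin in yC.
  by move=> e; rewrite e tauCin in xC.
pose rho := perm hinj.
(* The product of permutations acts from left to right: row [rho i] receives the column [s i]. *)
exists s, (rho^-1 * s)%g; split => //.
  have /set0Pn[x xC] := C0; apply/eqP => e.
  have : rho x = x.
    apply: (@perm_inj _ s).
    by rewrite [in LHS]e permM permK.
  rewrite permE /h xC => tx; have [_ /eqP] := tauP x (fintype.subsetP CI x xC).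
  by rewrite tx.
move=> p; apply: (le_trans (smax p)).
rewrite /perm_weight [leRHS](reindex_inj (@perm_inj _ rho)) /=.
under [leRHS]eq_bigr => i _ do rewrite permM permK permE /h.
rewrite (bigID (mem C))/= [leRHS](bigID (mem C))/=.
apply: lerD; last first.
  by apply: ler_sum => i /negbTE ->.
have -> : \sum_(i in C) A (if i \in C then tau i else i) (s i)
    = \sum_(i in C) A (tau i) (s i) by apply: eq_bigr => i ->.
have sumr : \sum_(i in C) r (tau i) = \sum_(i in C) r i.
  rewrite -(big_imset _ tauinj)/=; apply: eq_bigl => i.
  have -> // : (tau @: C)%SET = C.
  by apply/eqP; rewrite eqEcard tauC card_in_imset //=.
rewrite -(lerD2l (\sum_(i in C) r i)) -{2}sumr -!big_split/=.
by apply: ler_sum => i iC; have [] := tauP i (fintype.subsetP CI i iC).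
Qed.

Lemma tropically_nonsingular_open A : ~ tropically_singular A ->
  exists2 eta, 0 < eta &
    forall A', (forall i j, `|A' i j - A i j| <= eta) -> ~ tropically_singular A'.
Proof.
move=> nsA.
pose s := [arg max_(p > (1%g : {perm 'I_n})) perm_weight A p]%O.
have smax p : perm_weight A p <= perm_weight A s.
  by rewrite /s; case: arg_maxP => // m _; exact.
have [c c0 cP] : exists2 c, 0 < c & forall p, p != s -> c <= perm_weight A s - perm_weight A p.
  apply: finite_pos_lower_bound => p ps; rewrite subr_gt0 ltNge; apply/negP => sp.
  apply: nsA; exists s, p; split => //; first by rewrite eq_sym.
  by move=> r; apply: le_trans sp.
(* [c] is the gap between the unique optimum and the other weights. Entries moved by at most
   c/(2n+1) change a weight by at most nc/(2n+1), less than c/2; the added 1 also covers n = 0. *)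
have N0 : 0 < (n.*2.+1)%:R :> R by rewrite ltr0n.
exists (c / n.*2.+1%:R); first exact: divr_gt0.
move=> A' AA' [s1 [s2 [s12 s1max s2max]]].
have close p : `|perm_weight A' p - perm_weight A p| <= n%:R * (c / n.*2.+1%:R).
  rewrite /perm_weight -sumrB (le_trans (ler_norm_sum _ _ _))//.
  rewrite (le_trans (y := \sum_(i < n) (c / n.*2.+1%:R)))//.
    by apply: ler_sum => i _; exact: AA'.
  by rewrite sumr_const card_ord mulr_natl.
have [p ps pmax] : exists2 p, p != s & forall r, perm_weight A' r <= perm_weight A' p.
  have [e|ne] := eqVneq s1 s; last by exists s1.
  by exists s2 => //; rewrite -e eq_sym.
have := pmax s; have := cP p ps; have := close p; have := close s.
have : 2 * (n%:R * (c / n.*2.+1%:R)) < c.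
  by rewrite !mulrA ltr_pdivrMr// mulrC ltr_pM2l// -natrM ltr_nat mul2n ltnS.
move: (n%:R * _) => delta.
rewrite !ler_norml => h /andP[h1 h2] /andP[h3 h4] h5 h6; lra.
Qed.

End TropicalMatrix.

(** * The Euler-Jacobi dependency *)

Section BigMax.
Variable R : realType.

Lemma le_bigmax_mem (I : eqType) (s : seq I) (F : I -> R) (c : R) i :
  i \in s -> F i <= \big[Order.max/c]_(k <- s) F k.
Proof.
elim: s => // j s IH; rewrite inE big_cons le_max => /orP[/eqP->|/IH->].
  by rewrite lexx.
by rewrite orbT.
Qed.

Lemma bigmax_attained (I : eqType) (s : seq I) (F : I -> R) (c : R) :
  c < \big[Order.max/c]_(k <- s) F k ->
  exists2 i, i \in s & \big[Order.max/c]_(k <- s) F k = F i.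
Proof.
elim: s => [|j s IH]; first by rewrite big_nil ltxx.
rewrite big_cons; case: (leP (F j)) => [_ /IH[i si ->]|_ _].
  by exists i => //; rewrite inE si orbT.
by exists j => //; rewrite mem_head.
Qed.

Lemma bigmax_continuous (I : eqType) (s : seq I) (F : I -> R -> R) (c : R) :
  (forall i, i \in s -> continuous (F i)) ->
  continuous (fun t => \big[Order.max/c]_(k <- s) F k t).
Proof.
elim: s => [|j s IH] cF.
  by under eq_fun do rewrite big_nil; move=> t; exact: cvg_cst.
under eq_fun do rewrite big_cons.
apply: (@max_fun_continuous _ _ _ (F j)); first by apply: cF; rewrite mem_head.
by apply: IH => i si; apply: cF; rewrite inE si orbT.
Qed.

End BigMax.

Section SecondCrossing.
Variable R : realType.
Implicit Types (f g : nat -> nat -> R) (x q : R * R) (u w : nat * nat).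

(** The seed of the maximum is the constant monomial, itself one of those in [exps m], so it does
    not alter the value. *)
Definition tropical_value m a x : R :=
  \big[Order.max/tropical_monomial a (0, 0)%N x]_(u <- exps m) tropical_monomial a u x.

Lemma tropical_value_ge m a x u : (u.1 + u.2 <= m)%N ->
  tropical_monomial a u x <= tropical_value m a x.
Proof. by move=> um; apply: (le_bigmax_mem (tropical_monomial a ^~ x)); rewrite mem_exps. Qed.

Lemma tropical_value_maximal m a x u : maximal_exponents m a x u ->
  tropical_value m a x = tropical_monomial a u x.
Proof.
move=> [um umax]; apply/eqP; rewrite eq_le tropical_value_ge// andbT.
rewrite /tropical_value big_seq; elim/big_ind: _ => [|y z hy hz|w]; first exact: umax.
  by rewrite ge_max hy.
by rewrite mem_exps => wm; exact: umax.
Qed.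

(* The four closed cones opposite to the corners of a unimodular parallelogram
   contain every lattice point. *)
Lemma unimodular_corner u0 u1 w0 w1 (i j : nat) :
  edge_det int u0 u1 w0 w1 \in [:: 1; -1] ->
  exists us u' ws w', [/\ (us, u') = (u0, u1) \/ (us, u') = (u1, u0),
    (ws, w') = (w0, w1) \/ (ws, w') = (w1, w0) &
    exists al be : R, [/\ 0 <= al, 0 <= be,
      i%:R - us.1%:R - ws.1%:R = al * (us.1%:R - u'.1%:R) + be * (ws.1%:R - w'.1%:R) &
      j%:R - us.2%:R - ws.2%:R = al * (us.2%:R - u'.2%:R) + be * (ws.2%:R - w'.2%:R)]].
Proof.
move=> D1; set D := edge_det int u0 u1 w0 w1 in D1.
have DD : D * D = 1 by move: D1; rewrite !inE => /orP[] /eqP ->.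
pose t1 : int := i%:R - u0.1%:R - w0.1%:R; pose t2 : int := j%:R - u0.2%:R - w0.2%:R.
(* Cramer's rule for the coordinates of (i, j) - u0 - w0 along the two edges; [D] is its own
   inverse, so they are integers. *)
pose c1 := D * (t1 * (w1.2%:R - w0.2%:R) - t2 * (w1.1%:R - w0.1%:R)).
pose c2 := D * ((u1.1%:R - u0.1%:R) * t2 - (u1.2%:R - u0.2%:R) * t1).
have e1 : t1 = c1 * (u1.1%:R - u0.1%:R) + c2 * (w1.1%:R - w0.1%:R).
  transitivity (t1 * (D * D)); first by rewrite DD mulr1.
  by rewrite /c1 /c2 -{2}/D {2}/D /edge_det; ring.
have e2 : t2 = c1 * (u1.2%:R - u0.2%:R) + c2 * (w1.2%:R - w0.2%:R).
  transitivity (t2 * (D * D)); first by rewrite DD mulr1.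
  by rewrite /c1 /c2 -{2}/D {2}/D /edge_det; ring.
have toR (a b c d : nat) (k k' : int) (x y z x' y' : nat) :
    (x%:R - y%:R - z%:R : int) = k * (a%:R - b%:R) + k' * (c%:R - d%:R) ->
    (x%:R - y%:R - z%:R : R) = k%:~R * (a%:R - b%:R) + k'%:~R * (c%:R - d%:R).
  by move/(congr1 (intr : int -> R)); rewrite !(rmorphD, rmorphM, rmorphMNn, rmorph_nat, rmorphN, rmorph1).
have {e1 e2} [e1 e2] : (i%:R - u0.1%:R - w0.1%:R : R) =
    c1%:~R * (u1.1%:R - u0.1%:R) + c2%:~R * (w1.1%:R - w0.1%:R) /\
   (j%:R - u0.2%:R - w0.2%:R : R) =
    c1%:~R * (u1.2%:R - u0.2%:R) + c2%:~R * (w1.2%:R - w0.2%:R).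
  by split; apply: toR.
(* No integer lies strictly between 0 and 1. The alternative for each coordinate selects the
   corner. *)
have sgn (c : int) : (0 <= - c%:~R :> R) \/ (0 <= c%:~R - 1 :> R).
  have [h|h] := lerP c 0; [left | right].
    by rewrite oppr_ge0 lerz0.
  by rewrite subr_ge0 ler1z; lia.
have [h1|h1] := sgn c1; have [h2|h2] := sgn c2.
- exists u0, u1, w0, w1; split; [by left | by left | exists (- c1%:~R), (- c2%:~R)].
  split => //; lra.
- exists u0, u1, w1, w0; split; [by left | by right | exists (- c1%:~R), (c2%:~R - 1)].
  split => //; lra.
- exists u1, u0, w0, w1; split; [by right | by left | exists (c1%:~R - 1), (- c2%:~R)].
  split => //; lra.
- exists u1, u0, w1, w0; split; [by right | by right | exists (c1%:~R - 1), (c2%:~R - 1)].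
  split => //; lra.
Qed.

Lemma edge_det_int u0 u1 w0 w1 : edge_det R u0 u1 w0 w1 = (edge_det int u0 u1 w0 w1)%:~R.
Proof. by rewrite /edge_det !(rmorphD, rmorphN, rmorphM, rmorphMNn, rmorph_nat, rmorph1). Qed.

Definition unimodular_at d e f g q : Prop := forall u0 u1 w0 w1,
  maximal_exponents d f q u0 -> maximal_exponents d f q u1 -> u0 != u1 ->
  maximal_exponents e g q w0 -> maximal_exponents e g q w1 -> w0 != w1 ->
  edge_det int u0 u1 w0 w1 \in [:: 1; -1].

(** A third exponent would give three determinants equal to 1 or -1, one of them the sum of the
    other two, against parity. *)
Lemma unimodular_at_pair d e f g q u0 u1 w0 w1 : unimodular_at d e f g q ->
  maximal_exponents d f q u0 -> maximal_exponents d f q u1 -> u0 != u1 ->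
  maximal_exponents e g q w0 -> maximal_exponents e g q w1 -> w0 != w1 ->
  (forall u, maximal_exponents d f q u -> u = u0 \/ u = u1) /\
  (forall w, maximal_exponents e g q w -> w = w0 \/ w = w1).
Proof.
move=> um P0 P1 u01 Q0 Q1 w01; split => [u Pu|w Qw].
  have [->|u0u] := eqVneq u u0; first by left.
  have [->|u1u] := eqVneq u u1; first by right.
  rewrite eq_sym in u0u; rewrite eq_sym in u1u.
  have := um _ _ _ _ P0 P1 u01 Q0 Q1 w01.
  have := um _ _ _ _ P0 Pu u0u Q0 Q1 w01.
  have := um _ _ _ _ P1 Pu u1u Q0 Q1 w01.
  have : edge_det int u0 u w0 w1 = edge_det int u0 u1 w0 w1 + edge_det int u1 u w0 w1.
    by rewrite /edge_det; ring.
  by rewrite !inE; lia.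
have [->|w0w] := eqVneq w w0; first by left.
have [->|w1w] := eqVneq w w1; first by right.
rewrite eq_sym in w0w; rewrite eq_sym in w1w.
have := um _ _ _ _ P0 P1 u01 Q0 Q1 w01.
have := um _ _ _ _ P0 P1 u01 Q0 Qw w0w.
have := um _ _ _ _ P0 P1 u01 Q1 Qw w1w.
have : edge_det int u0 u1 w0 w = edge_det int u0 u1 w0 w1 + edge_det int u0 u1 w1 w.
  by rewrite /edge_det; ring.
by rewrite !inE; lia.
Qed.

(* Along the rays from q into the cell where u* and w* are maximal, the
   boundaries of the two cells of f and g are reached at the inverse distances
   rho_f and rho_g, which must agree on some ray by the intermediate value
   theorem. *)
Lemma second_crossing d e f g q (i j : nat) :
  transversal d e f g -> crossing d e f g q -> unimodular_at d e f g q ->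
  (0 < i)%N -> (0 < j)%N -> (i + j < d + e)%N ->
  exists x, [/\ x != q, crossing d e f g x &
    tropical_value d f x + tropical_value e g x - dot (i, j) x <=
    tropical_value d f q + tropical_value e g q - dot (i, j) q].
Proof.
move=> tr [u0 [u1 [w0 [w1 [P0 P1 Q0 Q1 det0]]]]] um i0 j0 ijde.
have u01 : u0 != u1.
  by apply: contraNneq det0 => ->; rewrite /edge_det !subrr !mul0r subrr.
have w01 : w0 != w1.
  by apply: contraNneq det0 => ->; rewrite /edge_det !subrr !mulr0 subrr.
have [Ponly Qonly] := unimodular_at_pair um P0 P1 u01 Q0 Q1 w01.
have [us [u' [ws [w' [uE wE [al [be [al0 be0 ei ej]]]]]]]] :=
  unimodular_corner i j (um _ _ _ _ P0 P1 u01 Q0 Q1 w01).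
have [Ps P' usu' {}Ponly] : [/\ maximal_exponents d f q us, maximal_exponents d f q u',
    us != u' & forall u, maximal_exponents d f q u -> u = us \/ u = u'].
  case: uE => -[-> ->]; split => //; first by rewrite eq_sym.
  by move=> u /Ponly[]; [right | left].
have [Qs Q' wsw' {}Qonly] : [/\ maximal_exponents e g q ws, maximal_exponents e g q w',
    ws != w' & forall w, maximal_exponents e g q w -> w = ws \/ w = w'].
  case: wE => -[-> ->]; split => //; first by rewrite eq_sym.
  by move=> w /Qonly[]; [right | left].
pose D : R := edge_det R us u' ws w'.
have DD : D * D = 1.
  have := um _ _ _ _ Ps P' usu' Qs Q' wsw'; rewrite /D edge_det_int !inE.
  by move=> /orP[] /eqP ->; rewrite ?mulrNN mulr1.
(* The directions in which [us] gains t on [u'] and [ws] gains 1 - t on [w']. For t in [0, 1] they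
   sweep the local cell of the corner, with an edge of f at t = 0 and an edge of g at t = 1. *)
pose eta (t : R) : R * R :=
  ((1 - t) * (D * (u'.2%:R - us.2%:R)) + t * (D * (ws.2%:R - w'.2%:R)),
   (1 - t) * (D * (us.1%:R - u'.1%:R)) + t * (D * (w'.1%:R - ws.1%:R))).
have aeta t : dot us (eta t) - dot u' (eta t) = t.
  transitivity (t * (D * D)); last by rewrite DD mulr1.
  by rewrite {2}/D /dot /eta /edge_det /=; ring.
have beta t : dot ws (eta t) - dot w' (eta t) = 1 - t.
  transitivity ((1 - t) * (D * D)); last by rewrite DD mulr1.
  by rewrite {2}/D /dot /eta /edge_det /=; ring.
pose slf k := tropical_monomial f us q - tropical_monomial f k q.
pose slg k := tropical_monomial g ws q - tropical_monomial g k q.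
pose Ef := [seq k <- exps d | (k != us) && (k != u')].
pose Eg := [seq k <- exps e | (k != ws) && (k != w')].
have slf0 k : k \in Ef -> 0 < slf k.
  rewrite mem_filter mem_exps => /andP[/andP[k1 k2] kd]; rewrite subr_gt0 lt_neqAle.
  have [_ Pmax] := Ps; rewrite Pmax// andbT; apply/eqP => h.
  have : maximal_exponents d f q k by split => // w wd; rewrite h Pmax.
  by move/Ponly => [] /eqP; apply/negP.
have slg0 k : k \in Eg -> 0 < slg k.
  rewrite mem_filter mem_exps => /andP[/andP[k1 k2] kd]; rewrite subr_gt0 lt_neqAle.
  have [_ Pmax] := Qs; rewrite Pmax// andbT; apply/eqP => h.
  have : maximal_exponents e g q k by split => // w wd; rewrite h Pmax.
  by move/Qonly => [] /eqP; apply/negP.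
pose Ff k t := (dot k (eta t) - dot us (eta t)) / slf k.
pose Fg k t := (dot k (eta t) - dot ws (eta t)) / slg k.
(* The seed 0 stands for a ray that never leaves the cell; inverse distances stay finite and
   continuous there. *)
pose rf t := \big[Order.max/0]_(k <- Ef) Ff k t.
pose rg t := \big[Order.max/0]_(k <- Eg) Fg k t.
have eta_cont k k' (c : R) : continuous (fun t => (dot k (eta t) - dot k' (eta t)) / c).
  have -> : (fun t => (dot k (eta t) - dot k' (eta t)) / c) =
     (fun t => (dot k (eta 0) - dot k' (eta 0)) / c +
       t * (((dot k (eta 1) - dot k' (eta 1)) - (dot k (eta 0) - dot k' (eta 0))) / c)).
    apply/funext => t; rewrite mulrA -mulrDl; congr (_ / _).
    by rewrite /dot /eta /=; ring.
  move=> t; apply: cvgD; first exact: cvg_cst.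
  by apply: cvgM; [exact: cvg_id | exact: cvg_cst].
have rfc : continuous rf by apply: bigmax_continuous => k _; exact: eta_cont.
have rgc : continuous rg by apply: bigmax_continuous => k _; exact: eta_cont.
have dotle_f t r : 0 <= t -> 0 <= r -> rf t <= r -> forall k, (k.1 + k.2 <= d)%N ->
    dot k (eta t) - dot us (eta t) <= r * slf k.
  move=> t0 r0 rr k kd; have [->|k1] := eqVneq k us.
    by rewrite /slf !subrr mulr0.
  have [->|k2] := eqVneq k u'.
    rewrite -opprB aeta (le_trans (y := 0)) ?oppr_le0//.
    by rewrite mulr_ge0// subr_ge0; case: Ps => _; apply; case: P'.
  have kE : k \in Ef by rewrite mem_filter k1 k2 mem_exps.
  rewrite -ler_pdivrMr ?slf0//; apply: le_trans rr.
  exact: (le_bigmax_mem (Ff ^~ t)).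
have dotle_g t r : t <= 1 -> 0 <= r -> rg t <= r -> forall k, (k.1 + k.2 <= e)%N ->
    dot k (eta t) - dot ws (eta t) <= r * slg k.
  move=> t0 r0 rr k kd; have [->|k1] := eqVneq k ws.
    by rewrite /slg !subrr mulr0.
  have [->|k2] := eqVneq k w'.
    rewrite -opprB beta (le_trans (y := 0)) ?oppr_le0 ?subr_ge0//.
    by rewrite mulr_ge0// subr_ge0; case: Qs => _; apply; case: Q'.
  have kE : k \in Eg by rewrite mem_filter k1 k2 mem_exps.
  rewrite -ler_pdivrMr ?slg0//; apply: le_trans rr.
  exact: (le_bigmax_mem (Fg ^~ t)).
(* The choice of the corner pays here: phi is nonincreasing along every ray of the cell. *)
have dot_ij x : dot us x + dot ws x - dot (i, j) x =
    - (al * (dot us x - dot u' x) + be * (dot ws x - dot w' x)).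
  transitivity (- ((i%:R - us.1%:R - ws.1%:R) * x.1 + (j%:R - us.2%:R - ws.2%:R) * x.2)).
    by rewrite /dot /=; ring.
  by rewrite ei ej /dot; ring.
have eta_neq0 t : ~ ((eta t).1 = 0 /\ (eta t).2 = 0).
  move=> [h1 h2]; have := aeta t; have := beta t; rewrite /dot h1 h2; lra.
(* If the ray left neither cell, [us + ws] would maximize [eta t] over (d + e) Delta, yet its value
   is at most that of the interior point (i, j). A linear form with an interior maximum vanishes,
   but [eta t] does not. *)
have pos t : 0 <= t -> t <= 1 -> 0 < rf t \/ 0 < rg t.
  move=> t0 t1; have [h|hf] := ltP 0 (rf t); first by left.
  have [h|hg] := ltP 0 (rg t); first by right.
  exfalso.
  have lf := dotle_f t 0 t0 (lexx 0) hf; have lg := dotle_g t 0 t1 (lexx 0) hg.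
  have f00 := lf (0, 0)%N (leq0n _); have g00 := lg (0, 0)%N (leq0n _).
  have f10 := lf (d, 0)%N; have g10 := lg (e, 0)%N.
  have f01 := lf (0, d)%N; have g01 := lg (0, e)%N.
  move: f10 g10 f01 g01; rewrite /= !addn0 !add0n => /(_ (leqnn _)) f10 /(_ (leqnn _)) g10
    /(_ (leqnn _)) f01 /(_ (leqnn _)) g01.
  have hij := dot_ij (eta t); rewrite aeta beta in hij.
  have ab : 0 <= al * t + be * (1 - t) by rewrite addr_ge0// mulr_ge0// subr_ge0.
  move: f00 g00 f10 g10 f01 g01 hij.
  rewrite !mul0r; set A := dot us _; set B := dot ws _; rewrite /dot.
  have [y1 y1E] : exists y, y = (eta t).1 by exists (eta t).1.
  have [y2 y2E] : exists y, y = (eta t).2 by exists (eta t).2.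
  rewrite -y1E -y2E /= => f00 g00 f10 g10 f01 g01 hij.
  pose h := i%:R * y1 + j%:R * y2.
  have h0 : 0 <= h by rewrite /h; lra.
  have hd : (d + e)%:R * y1 <= h by rewrite natrD /h; lra.
  have he : (d + e)%:R * y2 <= h by rewrite natrD /h; lra.
  have iR : 1 <= i%:R :> R by rewrite ler1n.
  have jR : 1 <= j%:R :> R by rewrite ler1n.
  have sR : i%:R + j%:R + 1 <= (d + e)%:R :> R by rewrite -natrD natr1 ler_nat.
  set S : R := (d + e)%:R in hd he sR.
  have sum0 : i%:R * (h - S * y1) + j%:R * (h - S * y2) + (S - i%:R - j%:R) * h = 0.
    by rewrite /h; ring.
  have p1 : 0 <= i%:R * (h - S * y1) by rewrite mulr_ge0//; lra.
  have p2 : 0 <= j%:R * (h - S * y2) by rewrite mulr_ge0//; lra.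
  have p3 : 0 <= (S - i%:R - j%:R) * h by rewrite mulr_ge0//; lra.
  have z3 : h = 0.
    have : (S - i%:R - j%:R) * h = 0 by lra.
    by move/eqP; rewrite mulf_eq0 => /orP[] /eqP //; lra.
  have z1 : h - S * y1 = 0.
    have : i%:R * (h - S * y1) = 0 by lra.
    by move/eqP; rewrite mulf_eq0 => /orP[] /eqP //; lra.
  have z2 : h - S * y2 = 0.
    have : j%:R * (h - S * y2) = 0 by lra.
    by move/eqP; rewrite mulf_eq0 => /orP[] /eqP //; lra.
  have S0 : S != 0 by rewrite gt_eqF//; lra.
  apply: (eta_neq0 t); rewrite -y1E -y2E.
  move: z1 z2; rewrite z3 !sub0r => /eqP + /eqP.
  by rewrite !oppr_eq0 !mulf_eq0 !(negbTE S0) => /eqP -> /eqP ->.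
have rf0 t : 0 <= rf t.
  rewrite /rf; elim/big_rec: _ => // k y _ y0; by rewrite le_max y0 orbT.
have rg0 t : 0 <= rg t.
  rewrite /rg; elim/big_rec: _ => // k y _ y0; by rewrite le_max y0 orbT.
have att_f t : 0 < rf t -> exists k, [/\ (k.1 + k.2 <= d)%N, k != us &
    dot k (eta t) - dot us (eta t) = rf t * slf k].
  move=> /bigmax_attained[k kE kr]; exists k; rewrite [rf t]kr /Ff mulfVK ?gt_eqF ?slf0//.
  by move: kE; rewrite mem_filter mem_exps => /andP[/andP[]].
have att_g t : 0 < rg t -> exists k, [/\ (k.1 + k.2 <= e)%N, k != ws &
    dot k (eta t) - dot ws (eta t) = rg t * slg k].
  move=> /bigmax_attained[k kE kr]; exists k; rewrite [rg t]kr /Fg mulfVK ?gt_eqF ?slg0//.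
  by move: kE; rewrite mem_filter mem_exps => /andP[/andP[]].
have [t [r [t0 t1 r0 [rfr rgr] [[k [kd kus kE]] [m [me mws mE]]]]]] : exists t r,
  [/\ 0 <= t, t <= 1, 0 < r, rf t <= r /\ rg t <= r &
    (exists k, [/\ (k.1 + k.2 <= d)%N, k != us &
       dot k (eta t) - dot us (eta t) = r * slf k]) /\
    (exists k, [/\ (k.1 + k.2 <= e)%N, k != ws &
       dot k (eta t) - dot ws (eta t) = r * slg k])].
  have slu' : slf u' = 0 by rewrite /slf (maximal_exponents_tie Ps P') subrr.
  have slw' : slg w' = 0 by rewrite /slg (maximal_exponents_tie Qs Q') subrr.
  (* At t = 0 the ray runs along the edge of f, so if g is met first there, that point is a
     crossing; likewise at t = 1 with f and g exchanged. Otherwise [rf - rg] changes sign on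
     [0, 1]. *)
  have [h0|h0] := ltP (rf 0) (rg 0).
    have rg_pos : 0 < rg 0 by apply: le_lt_trans h0.
    exists 0, (rg 0); split => //; first by split => //; exact: ltW.
    split; last exact: att_g.
    exists u'; rewrite slu' mulr0 -opprB aeta oppr0; split => //; first by case: P'.
    by rewrite eq_sym.
  have [h1|h1] := ltP (rg 1) (rf 1).
    have rf_pos : 0 < rf 1 by apply: le_lt_trans h1.
    exists 1, (rf 1); split => //; first by split => //; exact: ltW.
    split; first exact: att_f.
    exists w'; rewrite slw' mulr0 -opprB beta subrr oppr0; split => //; first by case: Q'.
    by rewrite eq_sym.
  have [] := @IVT R (fun t => rf t - rg t) 0 1 0 ler01.
  - apply: continuous_subspaceT => t; apply: cvgB; [exact: rfc | exact: rgc].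
  - rewrite ge_min le_max !subr_ge0 !subr_le0 h0 h1 /= orbT //.
  move=> t; rewrite in_itv/= => /andP[t0 t1] /eqP; rewrite subr_eq0 => /eqP rr.
  have rpos : 0 < rf t by have [//|] := pos t t0 t1; rewrite rr.
  exists t, (rf t); split => //; first by rewrite rr.
  split; first exact: att_f.
  rewrite rr; apply: att_g; by rewrite -rr.
pose x : R * R := (q.1 + (eta t).1 / r, q.2 + (eta t).2 / r).
have monE a w : tropical_monomial a w x = tropical_monomial a w q + dot w (eta t) / r.
  by rewrite /tropical_monomial /x /dot /=; ring.
have cmpf w : (w.1 + w.2 <= d)%N -> tropical_monomial f w x <= tropical_monomial f us x.
  move=> wd; have := dotle_f t r t0 (ltW r0) rfr w wd.
  rewrite !monE /slf mulrC -ler_pdivrMr// mulrBl; lra.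
have cmpg w : (w.1 + w.2 <= e)%N -> tropical_monomial g w x <= tropical_monomial g ws x.
  move=> wd; have := dotle_g t r t1 (ltW r0) rgr w wd.
  rewrite !monE /slg mulrC -ler_pdivrMr// mulrBl; lra.
have rn0 : r != 0 by rewrite gt_eqF.
have Psx : maximal_exponents d f x us by split => //; case: Ps.
have Qsx : maximal_exponents e g x ws by split => //; case: Qs.
have kx : tropical_monomial f k x = tropical_monomial f us x.
  have : (dot k (eta t) - dot us (eta t)) / r = slf k by rewrite kE mulrC mulKf.
  rewrite !monE /slf mulrBl; lra.
have mx : tropical_monomial g m x = tropical_monomial g ws x.
  have : (dot m (eta t) - dot ws (eta t)) / r = slg m by rewrite mE mulrC mulKf.
  rewrite !monE /slg mulrBl; lra.
have Pkx : maximal_exponents d f x k by split => // w wd; rewrite kx cmpf.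
have Qmx : maximal_exponents e g x m by split => // w wd; rewrite mx cmpg.
exists x; split.
- apply/eqP => xq; apply: (eta_neq0 t).
  have : x.1 = q.1 /\ x.2 = q.2 by rewrite xq.
  rewrite /x /= => -[h1 h2].
  by split; apply/eqP; rewrite -(mulIr_eq0 _ (mulIf (invr_neq0 rn0))); apply/eqP; lra.
- exists us, k, ws, m; split => //.
  by apply: (transversal_det tr Psx Pkx _ Qsx Qmx _); rewrite eq_sym.
rewrite (tropical_value_maximal Psx) (tropical_value_maximal Qsx).
rewrite (tropical_value_maximal Ps) (tropical_value_maximal Qs) !monE.
have -> : dot (i, j) x = dot (i, j) q + dot (i, j) (eta t) / r.
  by rewrite /dot /x /=; ring.
have : (dot us (eta t) + dot ws (eta t) - dot (i, j) (eta t)) / r <= 0.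
  rewrite dot_ij aeta beta mulNr oppr_le0; apply: divr_ge0; last exact: ltW.
  by rewrite addr_ge0// mulr_ge0// subr_ge0.
rewrite !mulrBl mulrDl; lra.
Qed.

End SecondCrossing.

(** * The Bezout bound *)

Section Covering.
Variable R : realType.
Implicit Types (a f g : nat -> nat -> R) (x y q z : R * R) (u w c : nat * nat).

(* Lattice points are moved by (1/M, 1/M^2), off all the lines through two
   exponents. *)
Definition shifted (M : nat) (c : nat * nat) : R * R :=
  (c.1%:R + M%:R^-1, c.2%:R + (M ^ 2)%:R^-1).

(** Multiplied by M^2, a vanishing value reads n1 - n2 M = k M^2 with k an integer. The bounds force
    k = 0, and then n1 = n2 M with |n1| < M forces both to vanish. *)
Lemma shift_generic (M : nat) (n1 n2 p1 p2 : int) :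
  `|n1| < M%:Z -> `|n2| < M%:Z -> (n1 != 0) || (n2 != 0) ->
  n1%:~R * (p2%:~R + (M ^ 2)%:R^-1) - n2%:~R * (p1%:~R + M%:R^-1) != 0 :> R.
Proof.
move=> h1 h2 n0; have M0 : (0 < M)%N by lia.
have MR : M%:R != 0 :> R by rewrite pnatr_eq0 -lt0n.
apply/eqP => e.
have : (n1 * p2 * M%:Z * M%:Z + n1 - n2 * p1 * M%:Z * M%:Z - n2 * M%:Z)%:~R = 0 :> R.
  rewrite !(rmorphD, rmorphN, rmorphM) /= -!pmulrn.
  transitivity (M%:R ^+ 2 * (n1%:~R * (p2%:~R + (M ^ 2)%:R^-1) - n2%:~R * (p1%:~R + M%:R^-1)) : R).
    by rewrite natrX; field.
  by rewrite e mulr0.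
move/eqP; rewrite intr_eq0 => /eqP {}e.
pose k := n2 * p1 - n1 * p2.
have ek : n1 - n2 * M%:Z = k * M%:Z * M%:Z by rewrite /k; nia.
have k0 : k = 0.
  have hb : `|n1 - n2 * M%:Z| < M%:Z * M%:Z by nia.
  by move: hb; rewrite ek; nia.
rewrite k0 !mul0r in ek.
have n20 : n2 = 0 by nia.
by move: n0 ek; rewrite n20; lia.
Qed.

Lemma exponents_shift_generic (M m : nat) u0 u1 w c : (m < M)%N ->
  (u0.1 + u0.2 <= m)%N -> (u1.1 + u1.2 <= m)%N -> u0 != u1 ->
  (u1.1%:R - u0.1%:R) * ((shifted M c).2 - w.2%:R)
  - (u1.2%:R - u0.2%:R) * ((shifted M c).1 - w.1%:R) != 0.
Proof.
move=> mM h0 h1 u01.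
have := @shift_generic M (u1.1%:Z - u0.1%:Z) (u1.2%:Z - u0.2%:Z)
  (c.1%:Z - w.1%:Z) (c.2%:Z - w.2%:Z).
rewrite !rmorphB /= -!pmulrn /shifted /= => h.
have -> : c.2%:R + (M ^ 2)%:R^-1 - w.2%:R = c.2%:R - w.2%:R + (M ^ 2)%:R^-1 :> R by ring.
have -> : c.1%:R + M%:R^-1 - w.1%:R = c.1%:R - w.1%:R + M%:R^-1 :> R by ring.
apply: h; [lia | lia |].
rewrite !subr_eq0; apply: contraNT u01; rewrite negb_or !negbK => /andP[/eqP e1 /eqP e2].
by rewrite [u0]surjective_pairing [u1]surjective_pairing; apply/eqP; congr pair; lia.
Qed.

(** Affine coordinates only: positivity is stated apart, because exponents outside the triangle are
    expanded in the same way. *)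
Definition in_triangle (u0 u1 u2 : nat * nat) (l0 l1 l2 : R) z : Prop :=
  [/\ l0 + l1 + l2 = 1,
      l0 * u0.1%:R + l1 * u1.1%:R + l2 * u2.1%:R = z.1 &
      l0 * u0.2%:R + l1 * u1.2%:R + l2 * u2.2%:R = z.2].

(** The barycentric coordinate of [z] at the vertex opposite to [u1 u2], as a quotient of signed
    areas. *)
Definition corner_weight (u1 u2 : nat * nat) (D : R) z : R :=
  ((u1.1%:R - z.1) * (u2.2%:R - z.2) - (u1.2%:R - z.2) * (u2.1%:R - z.1)) / D.

Lemma barycentric u0 u1 u2 z (D := edge_det R u0 u1 u0 u2) : D != 0 ->
  in_triangle u0 u1 u2 (corner_weight u1 u2 D z) (corner_weight u2 u0 D z)
    (corner_weight u0 u1 D z) z.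
Proof.
move=> D0.
have E (p1 p2 p3 q1 q2 q3 : R) :
    p1 / D * q1 + p2 / D * q2 + p3 / D * q3 = (p1 * q1 + p2 * q2 + p3 * q3) / D.
  by rewrite !(mulrAC _ D^-1) -!mulrDl.
split; rewrite /corner_weight ?E; last 2 first.
- by apply: (mulIf D0); rewrite mulfVK// /D /edge_det; ring.
- by apply: (mulIf D0); rewrite mulfVK// /D /edge_det; ring.
rewrite -!mulrDl; apply: (mulIf D0); rewrite mulfVK// /D /edge_det; ring.
Qed.

Lemma barycentric_uniq u0 u1 u2 (l0 l1 l2 : R) z (D := edge_det R u0 u1 u0 u2) :
  D != 0 -> in_triangle u0 u1 u2 l0 l1 l2 z ->
  [/\ l0 = corner_weight u1 u2 D z, l1 = corner_weight u2 u0 D z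
    & l2 = corner_weight u0 u1 D z].
Proof.
move=> D0 [s1 e1 e2]; rewrite /corner_weight -e1 -e2.
have -> : l0 = 1 - l1 - l2 by lra.
by split; apply: (mulIf D0); rewrite mulfVK// /D /edge_det; ring.
Qed.

(* One simplex pivot: exchanging u0 for w improves the interpolated value. *)
Lemma triangle_pivot (M m : nat) a c u0 u1 u2 w (l0 l1 l2 m0 m1 m2 V : R) :
  (m < M)%N ->
  u0 \in exps m -> u1 \in exps m -> u2 \in exps m -> w \in exps m ->
  edge_det R u0 u1 u0 u2 != 0 ->
  0 < l0 -> 0 < l1 -> 0 < l2 -> in_triangle u0 u1 u2 l0 l1 l2 (shifted M c) ->
  in_triangle u0 u1 u2 m0 m1 m2 (w.1%:R, w.2%:R) ->
  0 < m0 -> l0 * m1 <= l1 * m0 -> l0 * m2 <= l2 * m0 ->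
  V <= l0 * a u0.1 u0.2 + l1 * a u1.1 u1.2 + l2 * a u2.1 u2.2 ->
  (forall v0 v1 v2 k0 k1 k2, v0 \in exps m -> v1 \in exps m -> v2 \in exps m ->
     edge_det R v0 v1 v0 v2 != 0 -> 0 < k0 -> 0 < k1 -> 0 < k2 ->
     in_triangle v0 v1 v2 k0 k1 k2 (shifted M c) ->
     k0 * a v0.1 v0.2 + k1 * a v1.1 v1.2 + k2 * a v2.1 v2.2 <= V) ->
  a w.1 w.2 <= m0 * a u0.1 u0.2 + m1 * a u1.1 u1.2 + m2 * a u2.1 u2.2.
Proof.
move=> mM u0m u1m u2m wm D0 l00 l10 l20 [ls lx ly] [ms mx my] m00 r1 r2 Vle Vmax.
rewrite leNgt; apply/negP => lt.
(* Solving the expansion of [w] for [u0] and substituting it gives the shifted point the weights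
   [t], [k1], [k2] on [w], [u1], [u2]. *)
pose t := l0 / m0; have t0 : 0 < t by rewrite divr_gt0.
pose k1 := l1 - t * m1; pose k2 := l2 - t * m2.
have tm0 : t * m0 = l0 by rewrite mulfVK// gt_eqF.
have k1ge : 0 <= k1.
  rewrite /k1 /t subr_ge0 mulrAC ler_pdivrMr//.
have k2ge : 0 <= k2.
  rewrite /k2 /t subr_ge0 mulrAC ler_pdivrMr//.
have D'0 : edge_det R w u1 w u2 != 0.
  have -> : edge_det R w u1 w u2 = m0 * edge_det R u0 u1 u0 u2.
    rewrite /= in mx my.
    rewrite /edge_det -mx -my (_ : m0 = 1 - m1 - m2); last by lra.
    by ring.
  by rewrite mulf_neq0// gt_eqF.
have ks : t + k1 + k2 = 1.
  have : t * (m0 + m1 + m2) = t by rewrite ms mulr1.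
  by rewrite /k1 /k2 !mulrDr tm0; lra.
have kx : t * w.1%:R + k1 * u1.1%:R + k2 * u2.1%:R = (shifted M c).1.
  rewrite /= in mx; rewrite -lx -mx -tm0 /k1 /k2; ring.
have ky : t * w.2%:R + k1 * u1.2%:R + k2 * u2.2%:R = (shifted M c).2.
  rewrite /= in my; rewrite -ly -my -tm0 /k1 /k2; ring.
have wu1 : w != u1 by apply: contraNneq D'0 => ->; rewrite /edge_det !subrr !mul0r subrr.
have wu2 : w != u2 by apply: contraNneq D'0 => ->; rewrite /edge_det !subrr !mulr0 subrr.
rewrite !mem_exps in u0m u1m u2m wm.
(* A zero weight would place the shifted point on a line through two exponents. *)
have k10 : 0 < k1.
  rewrite lt_neqAle k1ge andbT; apply/eqP => /esym k1e.
  have := @exponents_shift_generic M m w u2 w c mM wm u2m wu2.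
  rewrite -kx -ky k1e (_ : t = 1 - k2); last by lra.
  by apply/negP; rewrite negbK; apply/eqP; ring.
have k20 : 0 < k2.
  rewrite lt_neqAle k2ge andbT; apply/eqP => /esym k2e.
  have := @exponents_shift_generic M m w u1 w c mM wm u1m wu1.
  rewrite -kx -ky k2e (_ : t = 1 - k1); last by lra.
  by apply/negP; rewrite negbK; apply/eqP; ring.
have := Vmax w u1 u2 t k1 k2; rewrite !mem_exps => /(_ wm u1m u2m D'0 t0 k10 k20).
have intri : in_triangle w u1 u2 t k1 k2 (shifted M c) by split.
move=> /(_ intri); apply/negP; rewrite -ltNge; apply: (le_lt_trans Vle).
rewrite -subr_gt0.
have -> : t * a w.1 w.2 + k1 * a u1.1 u1.2 + k2 * a u2.1 u2.2 -
   (l0 * a u0.1 u0.2 + l1 * a u1.1 u1.2 + l2 * a u2.1 u2.2) =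
   t * (a w.1 w.2 - (m0 * a u0.1 u0.2 + m1 * a u1.1 u1.2 + m2 * a u2.1 u2.2)).
  by rewrite -tm0 /k1 /k2; ring.
by rewrite mulr_gt0// subr_gt0.
Qed.

Lemma in_triangle_rot u0 u1 u2 (l0 l1 l2 : R) z :
  in_triangle u0 u1 u2 l0 l1 l2 z -> in_triangle u1 u2 u0 l1 l2 l0 z.
Proof. by move=> [s1 s2 s3]; split; [rewrite -s1 | rewrite -s2 | rewrite -s3]; ring. Qed.

Lemma edge_det_rot u0 u1 u2 : edge_det R u1 u2 u1 u0 = edge_det R u0 u1 u0 u2.
Proof. by rewrite /edge_det; ring. Qed.

(** Linear programming duality: among the triangles of exponents around the shifted point, take one
    with the largest interpolated coefficient. No pivot improves it, so its interpolating affine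
    function lies above all coefficients, and the slope of that function is -x. *)
Lemma dual_triangle (M m : nat) a c : (m < M)%N -> (1 < M)%N -> (c.1 + c.2 < m)%N ->
  exists x u0 u1 u2 l0 l1 l2,
    [/\ maximal_exponents m a x u0, maximal_exponents m a x u1
       & maximal_exponents m a x u2] /\
    [/\ edge_det R u0 u1 u0 u2 != 0, 0 < l0, 0 < l1, 0 < l2
       & in_triangle u0 u1 u2 l0 l1 l2 (shifted M c)].
Proof.
move=> mM M1 cm; set z := shifted M c.
pose tD (t : (nat * nat) * ((nat * nat) * (nat * nat))) := edge_det R t.1 t.2.1 t.1 t.2.2.
pose L0 t := corner_weight t.2.1 t.2.2 (tD t) z.
pose L1 t := corner_weight t.2.2 t.1 (tD t) z.
pose L2 t := corner_weight t.1 t.2.1 (tD t) z.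
pose good t := [&& tD t != 0, 0 < L0 t, 0 < L1 t & 0 < L2 t].
pose val t := L0 t * a t.1.1 t.1.2 + L1 t * a t.2.1.1 t.2.1.2 + L2 t * a t.2.2.1 t.2.2.2.
pose s := [seq t <- [seq (v0, v) | v0 <- exps m, v <- [seq (v1, v2) | v1 <- exps m, v2 <- exps m]] | good t].
have ins t : t \in s = [&& good t, t.1 \in exps m, t.2.1 \in exps m & t.2.2 \in exps m].
  rewrite mem_filter; congr (_ && _); case: t => t0 [t1 t2].
  apply/allpairsPdep/and3P => [[v0 [v [v0m /allpairsPdep[v1 [v2 [v1m v2m ->]]] [-> -> ->]]]]|[h0 h1 h2]].
    by split.
  by exists t0, (t1, t2); split => //; apply/allpairsPdep; exists t1, t2.
have m0 : (0 < m)%N by lia.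
have goodrel v0 v1 v2 k0 k1 k2 : v0 \in exps m -> v1 \in exps m -> v2 \in exps m ->
     edge_det R v0 v1 v0 v2 != 0 -> 0 < k0 -> 0 < k1 -> 0 < k2 ->
     in_triangle v0 v1 v2 k0 k1 k2 z ->
     (v0, (v1, v2)) \in s /\ k0 * a v0.1 v0.2 + k1 * a v1.1 v1.2 + k2 * a v2.1 v2.2 = val (v0, (v1, v2)).
  move=> v0m v1m v2m D0 k00 k10 k20 tri; have [e0 e1 e2] := barycentric_uniq D0 tri.
  split; last by rewrite /val /L0 /L1 /L2 /tD /= -e0 -e1 -e2.
  by rewrite ins /= v0m v1m v2m /good /L0 /L1 /L2 /tD /= -e0 -e1 -e2 D0 k00 k10 k20.
have mR : 0 < m%:R :> R by rewrite ltr0n.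
have MR : 1 < M%:R :> R by rewrite ltr1n.
have d1 : 0 < M%:R^-1 :> R by rewrite invr_gt0; lra.
have d2 : 0 < (M ^ 2)%:R^-1 :> R by rewrite invr_gt0 ltr0n expn_gt0; lia.
have d3 : M%:R^-1 + (M ^ 2)%:R^-1 < 1 :> R.
  have h2 : 2 <= M%:R :> R by rewrite ler_nat.
  rewrite -(ltr_pM2r (_ : 0 < (M ^ 2)%:R)) ?ltr0n ?expn_gt0; last by lia.
  have -> : (M%:R^-1 + (M ^ 2)%:R^-1) * (M ^ 2)%:R = M%:R + 1 :> R.
    by rewrite natrX; field; apply/eqP; lra.
  by rewrite natrX; nra.
have cmR : c.1%:R + c.2%:R + 1 <= m%:R :> R by rewrite -natrD natr1 ler_nat.
have [s0 s0P] : exists t, t \in s.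
  (* The whole Newton triangle is a candidate, since the shift moves the sum of the coordinates by
     less than 1. *)
  exists ((0, 0), ((m, 0), (0, m)))%N.
  apply: (proj1 (@goodrel _ _ _ (1 - z.1 / m%:R - z.2 / m%:R) (z.1 / m%:R) (z.2 / m%:R) _ _ _ _ _ _ _ _)).
  - by rewrite mem_exps.
  - by rewrite mem_exps /= addn0.
  - by rewrite mem_exps.
  - by rewrite /edge_det /= !subr0 mulr0 subr0 mulf_neq0// gt_eqF.
  - rewrite -addrA -opprD subr_gt0 -mulrDl ltr_pdivrMr// mul1r /z /shifted /=; lra.
  - by rewrite divr_gt0// /z /shifted /=; apply: ltr_wpDl.
  - by rewrite divr_gt0// /z /shifted /=; apply: ltr_wpDl.
  - by split; rewrite /=; [ring | rewrite !mulr0 add0r addr0 mulfVK ?gt_eqF | rewrite !mulr0 !add0r mulfVK ?gt_eqF].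
have [[u0 [u1 u2]] tP tmax] := seq_argmax val s0P.
move: (tP); rewrite ins /= => /andP[/and4P[D0 l00 l10 l20] /and3P[u0m u1m u2m]].
set l0 := L0 _ in l00; set l1 := L1 _ in l10; set l2 := L2 _ in l20.
have tri : in_triangle u0 u1 u2 l0 l1 l2 z by exact: barycentric.
set D := tD _ in D0; have DE : D = edge_det R u0 u1 u0 u2 by [].
pose V := val (u0, (u1, u2)).
have Vmax v0 v1 v2 k0 k1 k2 : v0 \in exps m -> v1 \in exps m -> v2 \in exps m ->
     edge_det R v0 v1 v0 v2 != 0 -> 0 < k0 -> 0 < k1 -> 0 < k2 ->
     in_triangle v0 v1 v2 k0 k1 k2 (shifted M c) ->
     k0 * a v0.1 v0.2 + k1 * a v1.1 v1.2 + k2 * a v2.1 v2.2 <= V.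
  move=> v0m v1m v2m vD k00 k10 k20 vtri.
  by have [vs ->] := goodrel _ _ _ _ _ _ v0m v1m v2m vD k00 k10 k20 vtri; exact: tmax.
pose a0 := a u0.1 u0.2; pose a1 := a u1.1 u1.2; pose a2 := a u2.1 u2.2.
pose x : R * R :=
  (((a0 - a1) * (u2.2%:R - u0.2%:R) - (a0 - a2) * (u1.2%:R - u0.2%:R)) / D,
   ((u1.1%:R - u0.1%:R) * (a0 - a2) - (u2.1%:R - u0.1%:R) * (a0 - a1)) / D).
have tie1 : tropical_monomial a u1 x = tropical_monomial a u0 x.
  apply: (mulIf D0); rewrite /tropical_monomial -/a0 -/a1 !mulrDl /x /=.
  by rewrite !(mulrA _ _ D^-1) !mulfVK// DE /edge_det; ring.
have tie2 : tropical_monomial a u2 x = tropical_monomial a u0 x.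
  apply: (mulIf D0); rewrite /tropical_monomial -/a0 -/a2 !mulrDl /x /=.
  by rewrite !(mulrA _ _ D^-1) !mulfVK// DE /edge_det; ring.
have wle w : w \in exps m -> tropical_monomial a w x <= tropical_monomial a u0 x.
  move=> wm.
  pose n0 := corner_weight u1 u2 D (w.1%:R, w.2%:R).
  pose n1 := corner_weight u2 u0 D (w.1%:R, w.2%:R).
  pose n2 := corner_weight u0 u1 D (w.1%:R, w.2%:R).
  have trin : in_triangle u0 u1 u2 n0 n1 n2 (w.1%:R, w.2%:R) by exact: barycentric.
  have [ns nx ny] := trin; rewrite /= in nx ny.
  suff : a w.1 w.2 <= n0 * a0 + n1 * a1 + n2 * a2.
    move=> h; rewrite -subr_ge0.
    have -> : tropical_monomial a u0 x - tropical_monomial a w x =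
        n0 * tropical_monomial a u0 x + n1 * tropical_monomial a u1 x
        + n2 * tropical_monomial a u2 x - tropical_monomial a w x.
      transitivity ((n0 + n1 + n2) * tropical_monomial a u0 x - tropical_monomial a w x).
        by rewrite ns mul1r.
      by rewrite tie1 tie2; ring.
    rewrite /tropical_monomial -nx -ny -/a0 -/a1 -/a2.
    have -> : forall X Y : R, n0 * (a0 + u0.1%:R * X + u0.2%:R * Y) + n1 * (a1 + u1.1%:R * X + u1.2%:R * Y) +
      n2 * (a2 + u2.1%:R * X + u2.2%:R * Y) - (a w.1 w.2 + (n0 * u0.1%:R + n1 * u1.1%:R + n2 * u2.1%:R) * X +
     (n0 * u0.2%:R + n1 * u1.2%:R + n2 * u2.2%:R) * Y) = n0 * a0 + n1 * a1 + n2 * a2 - a w.1 w.2.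
      by move=> X Y; ring.
    by rewrite subr_ge0.
  have rot1 := edge_det_rot u0 u1 u2; have rot2 := edge_det_rot u1 u2 u0.
  (* The leaving vertex is the one with the largest ratio, which keeps the other weights
     nonnegative. Its coordinate is positive because the coordinates of [w] sum to 1. *)
  have [p pin pmax] := @seq_argmax R _ [:: (l0, n0); (l1, n1); (l2, n2)]
    (fun p => p.2 / p.1) _ (mem_head _ _).
  have h0 := pmax _ (mem_head _ _).
  have h1 : n1 / l1 <= p.2 / p.1 by apply: (pmax (l1, n1)); rewrite !inE eqxx orbT.
  have h2 : n2 / l2 <= p.2 / p.1 by apply: (pmax (l2, n2)); rewrite !inE eqxx !orbT.
  rewrite /= in h0.
  have p1 : 0 < p.1 by move: pin; rewrite !inE => /or3P[] /eqP ->.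
  have p2 : 0 < p.2.
    rewrite ltNge; apply/negP => p2.
    have p20 : p.2 / p.1 <= 0 by rewrite ler_pdivrMr// mul0r.
    have npos l n : 0 < l -> n / l <= p.2 / p.1 -> n <= 0.
      by move=> lp /le_trans/(_ p20); rewrite pmulr_lle0 ?invr_gt0.
    have := npos _ _ l00 h0; have := npos _ _ l10 h1; have := npos _ _ l20 h2.
    by move: ns; clear; lra.
  have cross l n : 0 < l -> n / l <= p.2 / p.1 -> p.1 * n <= l * p.2.
    move=> lp; rewrite ler_pdivrMr// mulrAC ler_pdivlMr// => h.
    by rewrite mulrC [l * _]mulrC.
  have c0 := cross _ _ l00 h0; have c1 := cross _ _ l10 h1; have c2 := cross _ _ l20 h2.
  have tri1 := in_triangle_rot tri; have tri2 := in_triangle_rot tri1.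
  have trin1 := in_triangle_rot trin; have trin2 := in_triangle_rot trin1.
  move: pin; rewrite !inE => /or3P[] /eqP pE; rewrite pE /= in c0 c1 c2 p2.
  - apply: (@triangle_pivot M m a c u0 u1 u2 w l0 l1 l2 n0 n1 n2 V) => //.
  - rewrite (_ : n0 * a0 + n1 * a1 + n2 * a2 = n1 * a1 + n2 * a2 + n0 * a0); last by ring.
    apply: (@triangle_pivot M m a c u1 u2 u0 w l1 l2 l0 n1 n2 n0 V) => //.
      by rewrite rot1 -DE.
    by rewrite /V /val -/l0 -/l1 -/l2 /= le_eqVlt; apply/orP; left; apply/eqP; ring.
  - rewrite (_ : n0 * a0 + n1 * a1 + n2 * a2 = n2 * a2 + n0 * a0 + n1 * a1); last by ring.
    apply: (@triangle_pivot M m a c u2 u0 u1 w l2 l0 l1 n2 n0 n1 V) => //.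
      by rewrite rot2 rot1 -DE.
    by rewrite /V /val -/l0 -/l1 -/l2 /= le_eqVlt; apply/orP; left; apply/eqP; ring.
have max0 : maximal_exponents m a x u0.
  split; first by rewrite /exponents /= -mem_exps.
  by move=> w wm; apply: wle; rewrite mem_exps.
exists x, u0, u1, u2, l0, l1, l2; split; split => //.
  split; first by rewrite /exponents /= -mem_exps.
  by move=> w wm; rewrite tie1; apply: wle; rewrite mem_exps.
split; first by rewrite /exponents /= -mem_exps.
by move=> w wm; rewrite tie2; apply: wle; rewrite mem_exps.
Qed.

End Covering.

(** * Counting shifted points in the cells *)

Section Bezout.
Variable R : realType.
Implicit Types (f g : nat -> nat -> R) (x y q z : R * R) (u w c : nat * nat).

(* c + (1/M, 1/M^2) lies in the interior of the cell of the mixed subdivision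
   dual to x. *)
Definition dual_cell (M d e : nat) f g c x : Prop := forall y, y != x ->
  (shifted R M c).1 * (y.1 - x.1) + (shifted R M c).2 * (y.2 - x.2) <
  tropical_value d f y + tropical_value e g y
  - (tropical_value d f x + tropical_value e g x).

(** The strict inequality at [x] tested at [x'] and the one at [x'] tested at [x] add up to 0 <
    0. *)
Lemma dual_cell_inj M d e f g c x x' :
  dual_cell M d e f g c x -> dual_cell M d e f g c x' -> x = x'.
Proof.
move=> cx cx'; apply: contrapT => /eqP xx'.
have := cx' _ xx'; rewrite eq_sym in xx'; have := cx _ xx'; lra.
Qed.

Lemma dual_cellC M d e f g c x : dual_cell M e d g f c x -> dual_cell M d e f g c x.
Proof. by move=> h y yx; have := h y yx; lra. Qed.

Lemma tropical_value_diff m a x y u : maximal_exponents m a x u ->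
  u.1%:R * (y.1 - x.1) + u.2%:R * (y.2 - x.2) <=
  tropical_value m a y - tropical_value m a x.
Proof.
move=> ux; rewrite (tropical_value_maximal ux); case: ux => um _.
by have := tropical_value_ge a y um; rewrite /tropical_monomial; lra.
Qed.

Lemma neq_coord x y : y != x -> ~ (y.1 - x.1 = 0 /\ y.2 - x.2 = 0).
Proof.
move=> /eqP yx [h1 h2]; apply: yx.
by rewrite [x]surjective_pairing [y]surjective_pairing; congr pair; lra.
Qed.

(** The corners are subgradients of f + g at [x], and the shifted point is a positive combination of
    them. Equality at [y] would make [y - x] orthogonal to both edges. *)
Lemma parallelogram_dual_cell M d e f g c x u0 u1 w0 w1 (s t : R) :
  maximal_exponents d f x u0 -> maximal_exponents d f x u1 ->
  maximal_exponents e g x w0 -> maximal_exponents e g x w1 ->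
  edge_det R u0 u1 w0 w1 != 0 -> 0 < s < 1 -> 0 < t < 1 ->
  (shifted R M c).1 = u0.1%:R + w0.1%:R + s * (u1.1%:R - u0.1%:R) + t * (w1.1%:R - w0.1%:R) ->
  (shifted R M c).2 = u0.2%:R + w0.2%:R + s * (u1.2%:R - u0.2%:R) + t * (w1.2%:R - w0.2%:R) ->
  dual_cell M d e f g c x.
Proof.
move=> P0 P1 Q0 Q1 D0 /andP[s0 s1] /andP[t0 t1] z1 z2 y yx.
rewrite z1 z2; have := neq_coord yx.
have := tropical_value_diff y P0; have := tropical_value_diff y P1.
have := tropical_value_diff y Q0; have := tropical_value_diff y Q1.
set X := y.1 - x.1; set Y := y.2 - x.2; set F := _ - tropical_value d f x.
set G := _ - tropical_value e g x.
have -> : tropical_value d f y + tropical_value e g y -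
  (tropical_value d f x + tropical_value e g x) = F + G by rewrite /F /G; ring.
move: D0; rewrite /edge_det.
set A := u0.1%:R * X + _; set B := u1.1%:R * X + _.
set C := w0.1%:R * X + _; set E := w1.1%:R * X + _ => D0 EG CG BF AF XY.
have -> : (u0.1%:R + w0.1%:R + s * (u1.1%:R - u0.1%:R) + t * (w1.1%:R - w0.1%:R)) * X +
  (u0.2%:R + w0.2%:R + s * (u1.2%:R - u0.2%:R) + t * (w1.2%:R - w0.2%:R)) * Y =
  ((1 - s) * A + s * B) + ((1 - t) * C + t * E) by rewrite /A /B /C /E; ring.
have ABF : (1 - s) * A + s * B <= F by nra.
have CEG : (1 - t) * C + t * E <= G by nra.
have [eAB|nAB] := eqVneq A B.
  have [eCE|nCE] := eqVneq C E.
    exfalso; apply: XY; apply: (independent_dot_eq0 D0).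
      by move: eAB; rewrite /A /B; lra.
    by move: eCE; rewrite /C /E; lra.
  suff : (1 - t) * C + t * E < G by lra.
  by move: nCE; rewrite neq_lt => /orP[] ?; nra.
suff : (1 - s) * A + s * B < F by lra.
by move: nAB; rewrite neq_lt => /orP[] ?; nra.
Qed.

Lemma triangle_dual_cell M d e f g c w x u0 u1 u2 (l0 l1 l2 : R) :
  maximal_exponents d f x u0 -> maximal_exponents d f x u1 ->
  maximal_exponents d f x u2 -> maximal_exponents e g x w ->
  edge_det R u0 u1 u0 u2 != 0 -> 0 < l0 -> 0 < l1 -> 0 < l2 ->
  in_triangle u0 u1 u2 l0 l1 l2 (shifted R M c) ->
  dual_cell M d e f g (c.1 + w.1, c.2 + w.2)%N x.
Proof.
move=> P0 P1 P2 Q D0 l00 l10 l20 [ls lx ly] y yx.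
have -> : (shifted R M (c.1 + w.1, c.2 + w.2)%N).1 = (shifted R M c).1 + w.1%:R.
  by rewrite /shifted /= natrD; ring.
have -> : (shifted R M (c.1 + w.1, c.2 + w.2)%N).2 = (shifted R M c).2 + w.2%:R.
  by rewrite /shifted /= natrD; ring.
rewrite -lx -ly; have := neq_coord yx.
have := tropical_value_diff y P0; have := tropical_value_diff y P1.
have := tropical_value_diff y P2; have := tropical_value_diff y Q.
set X := y.1 - x.1; set Y := y.2 - x.2; set F := _ - tropical_value d f x.
set G := _ - tropical_value e g x.
have -> : tropical_value d f y + tropical_value e g y -
  (tropical_value d f x + tropical_value e g x) = F + G by rewrite /F /G; ring.
move: D0; rewrite /edge_det.
set A := u0.1%:R * X + _; set B := u1.1%:R * X + _.
set C := u2.1%:R * X + _; set E := w.1%:R * X + _ => D0 EG CF BF AF XY.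
have -> : (l0 * u0.1%:R + l1 * u1.1%:R + l2 * u2.1%:R + w.1%:R) * X +
  (l0 * u0.2%:R + l1 * u1.2%:R + l2 * u2.2%:R + w.2%:R) * Y =
  (l0 * A + l1 * B + l2 * C) + E by rewrite /A /B /C /E; ring.
suff : l0 * A + l1 * B + l2 * C < F by lra.
have FE : F = l0 * F + l1 * F + l2 * F by rewrite -!mulrDl ls mul1r.
have a0 : l0 * A <= l0 * F by rewrite ler_pM2l.
have b0 : l1 * B <= l1 * F by rewrite ler_pM2l.
have c0 : l2 * C <= l2 * F by rewrite ler_pM2l.
have [eA|nA] := eqVneq A F; last first.
  have : l0 * A < l0 * F by rewrite ltr_pM2l// lt_neqAle nA.
  lra.
have [eB|nB] := eqVneq B F; last first.
  have : l1 * B < l1 * F by rewrite ltr_pM2l// lt_neqAle nB.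
  lra.
have [eC|nC] := eqVneq C F; last first.
  have : l2 * C < l2 * F by rewrite ltr_pM2l// lt_neqAle nC.
  lra.
exfalso; apply: XY; apply: (independent_dot_eq0 D0).
  by move: eA; rewrite -eB /A /B; lra.
by move: eA; rewrite -eC /A /C; lra.
Qed.

(* Translating by the lattice spanned by two edges moves every lattice point
   into the open parallelogram. *)
Lemma parallelogram_point (M d e : nat) u0 u1 w0 w1 (p1 p2 : int) :
  (d < M)%N -> (e < M)%N ->
  (u0.1 + u0.2 <= d)%N -> (u1.1 + u1.2 <= d)%N ->
  (w0.1 + w0.2 <= e)%N -> (w1.1 + w1.2 <= e)%N ->
  edge_det R u0 u1 w0 w1 != 0 ->
  exists c (k l : int) (s t : R),
  [/\ (c.1 + c.2 < d + e)%N, 0 < s < 1, 0 < t < 1,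
   (c.1%:Z = p1 - k * (u1.1%:Z - u0.1%:Z) - l * (w1.1%:Z - w0.1%:Z)) /\
   (c.2%:Z = p2 - k * (u1.2%:Z - u0.2%:Z) - l * (w1.2%:Z - w0.2%:Z)) &
   (shifted R M c).1 = u0.1%:R + w0.1%:R + s * (u1.1%:R - u0.1%:R) + t * (w1.1%:R - w0.1%:R) /\
   (shifted R M c).2 = u0.2%:R + w0.2%:R + s * (u1.2%:R - u0.2%:R) + t * (w1.2%:R - w0.2%:R)].
Proof.
move=> dM eM hu0 hu1 hw0 hw1 D0.
have u01 : u0 != u1.
  by apply: contraNneq D0 => ->; rewrite /edge_det !subrr !mul0r subrr.
have w01 : w0 != w1.
  by apply: contraNneq D0 => ->; rewrite /edge_det !subrr !mulr0 subrr.
have M2 : (1 < M)%N.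
  apply: contraNT u01 => h; rewrite [u0]surjective_pairing [u1]surjective_pairing.
  by apply/eqP; congr pair; lia.
have ge0_int (r : int) : (-1)%:~R < r%:~R :> R -> 0 <= r by rewrite ltr_int; lia.
set D := edge_det R u0 u1 w0 w1 in D0.
pose d1 : R := M%:R^-1; pose d2 : R := (M ^ 2)%:R^-1.
pose a1 : R := u1.1%:R - u0.1%:R; pose a2 : R := u1.2%:R - u0.2%:R.
pose b1 : R := w1.1%:R - w0.1%:R; pose b2 : R := w1.2%:R - w0.2%:R.
have DE : D = a1 * b2 - a2 * b1 by [].
pose v1 : R := p1%:~R + d1 - u0.1%:R - w0.1%:R.
pose v2 : R := p2%:~R + d2 - u0.2%:R - w0.2%:R.
pose S := (v1 * b2 - v2 * b1) / D; pose T := (a1 * v2 - a2 * v1) / D.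
have ED (p q a b : R) : p / D * a + q / D * b = (p * a + q * b) / D.
  by rewrite !(mulrAC _ D^-1) -mulrDl.
have vE1 : v1 = S * a1 + T * b1.
  by rewrite /S /T ED; apply: (mulIf D0); rewrite mulfVK// DE; ring.
have vE2 : v2 = S * a2 + T * b2.
  by rewrite /S /T ED; apply: (mulIf D0); rewrite mulfVK// DE; ring.
pose k := Num.floor S; pose l := Num.floor T.
have nonint (n1 n2 r1 r2 : int) : `|n1| < M%:Z -> `|n2| < M%:Z ->
    (n1 != 0) || (n2 != 0) -> n1%:~R * (r2%:~R + d2) - n2%:~R * (r1%:~R + d1) != 0.
  exact: shift_generic.
have coord (u u' : nat * nat) : u != u' -> (u'.1%:Z - u.1%:Z != 0) || (u'.2%:Z - u.2%:Z != 0).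
  apply: contraNT; rewrite negb_or !negbK => /andP[/eqP h1 /eqP h2].
  by rewrite [u]surjective_pairing [u']surjective_pairing; apply/eqP; congr pair; lia.
have S0 : S != k%:~R.
  apply/eqP => Sk; have := @nonint (w1.1%:Z - w0.1%:Z) (w1.2%:Z - w0.2%:Z)
    (p1 - u0.1%:Z - w0.1%:Z - k * (u1.1%:Z - u0.1%:Z)) (p2 - u0.2%:Z - w0.2%:Z - k * (u1.2%:Z - u0.2%:Z)).
  rewrite !(rmorphB, rmorphM) /= -!pmulrn -/a1 -/a2 -/b1 -/b2 => h.
  have /eqP : _ != _ := h ltac:(lia) ltac:(lia) (coord _ _ w01); apply.
  transitivity (b1 * (v2 - k%:~R * a2) - b2 * (v1 - k%:~R * a1)); first by rewrite /v1 /v2; ring.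
  by rewrite vE1 vE2 Sk; ring.
have T0 : T != l%:~R.
  apply/eqP => Tl; have := @nonint (u1.1%:Z - u0.1%:Z) (u1.2%:Z - u0.2%:Z)
    (p1 - u0.1%:Z - w0.1%:Z - l * (w1.1%:Z - w0.1%:Z)) (p2 - u0.2%:Z - w0.2%:Z - l * (w1.2%:Z - w0.2%:Z)).
  rewrite !(rmorphB, rmorphM) /= -!pmulrn -/a1 -/a2 -/b1 -/b2 => h.
  have /eqP : _ != _ := h ltac:(lia) ltac:(lia) (coord _ _ u01); apply.
  transitivity (a1 * (v2 - l%:~R * b2) - a2 * (v1 - l%:~R * b1)); first by rewrite /v1 /v2; ring.
  by rewrite vE1 vE2 Tl; ring.
pose s := S - k%:~R; pose t := T - l%:~R.
have s01 : 0 < s < 1.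
  have /andP[h1 h2] := Num.Theory.floor_itv S; rewrite -/k in h1 h2.
  apply/andP; split; last by rewrite /s; move: h2; rewrite intrD; lra.
  by rewrite subr_gt0 lt_neqAle eq_sym S0.
have t01 : 0 < t < 1.
  have /andP[h1 h2] := Num.Theory.floor_itv T; rewrite -/l in h1 h2.
  apply/andP; split; last by rewrite /t; move: h2; rewrite intrD; lra.
  by rewrite subr_gt0 lt_neqAle eq_sym T0.
pose r1 := p1 - k * (u1.1%:Z - u0.1%:Z) - l * (w1.1%:Z - w0.1%:Z).
pose r2 := p2 - k * (u1.2%:Z - u0.2%:Z) - l * (w1.2%:Z - w0.2%:Z).
have rE1 : r1%:~R + d1 = u0.1%:R + w0.1%:R + s * a1 + t * b1.
  rewrite /r1 !(rmorphB, rmorphM) /= -!pmulrn -/a1 -/a2 -/b1 -/b2.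
  by have := vE1; rewrite /v1 /s /t; lra.
have rE2 : r2%:~R + d2 = u0.2%:R + w0.2%:R + s * a2 + t * b2.
  rewrite /r2 !(rmorphB, rmorphM) /= -!pmulrn -/a1 -/a2 -/b1 -/b2.
  by have := vE2; rewrite /v2 /s /t; lra.
have M0 : (0 < M)%N := ltn_trans (ltn0Sn 0) M2.
have d10 : 0 < d1 by rewrite invr_gt0 ltr0n.
have d20 : 0 < d2 by rewrite invr_gt0 ltr0n expn_gt0 M0.
have d11 : d1 < 1 by rewrite invf_lt1 ?ltr1n ?ltr0n.
have d21 : d2 < 1.
  by rewrite invf_lt1 ?ltr1n ?ltr0n ?expn_gt0 ?M0// (ltn_exp2l 0).
move: s01 t01 => /andP[s0 s1] /andP[t0 t1].
have conv_ge0 (n m : nat) (r : R) : 0 < r -> r < 1 -> 0 <= n%:R + r * (m%:R - n%:R).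
  move=> rr0 rr1; have n0 : (0 : R) <= n%:R by []; have m0 : (0 : R) <= m%:R by [].
  have : 0 <= (1 - r) * n%:R by rewrite mulr_ge0// subr_ge0 ltW.
  have : 0 <= r * m%:R by rewrite mulr_ge0// ltW.
  by lra.
have conv_le (n m N : nat) (r : R) : 0 < r -> r < 1 -> (n <= N)%N -> (m <= N)%N ->
    n%:R + r * (m%:R - n%:R) <= N%:R.
  move=> rr0 rr1; rewrite -!(ler_nat R) => h1 h2.
  have : 0 <= (1 - r) * (N%:R - n%:R) by rewrite mulr_ge0// subr_ge0// ltW.
  have : 0 <= r * (N%:R - m%:R) by rewrite mulr_ge0 ?subr_ge0// ltW.
  by lra.
(* The shifted coordinate is nonnegative and the shift is below 1, so the integer exceeds -1. In
   [r12] the positive shift gives the strict bound. *)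
have r10 : 0 <= r1.
  apply: ge0_int.
  have := conv_ge0 u0.1 u1.1 s s0 s1; have := conv_ge0 w0.1 w1.1 t t0 t1.
  by rewrite -/a1 -/b1 rmorphN1; lra.
have r20 : 0 <= r2.
  apply: ge0_int.
  have := conv_ge0 u0.2 u1.2 s s0 s1; have := conv_ge0 w0.2 w1.2 t t0 t1.
  by rewrite -/a2 -/b2 rmorphN1; lra.
have r12 : r1 + r2 < (d + e)%:Z.
  rewrite -(ltr_int R) rmorphD /= -pmulrn natrD.
  have := conv_le (u0.1 + u0.2)%N (u1.1 + u1.2)%N d s s0 s1 hu0 hu1.
  have := conv_le (w0.1 + w0.2)%N (w1.1 + w1.2)%N e t t0 t1 hw0 hw1.
  by move: rE1 rE2; rewrite !natrD /a1 /a2 /b1 /b2; lra.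
have n1E : (`|r1|%N)%:Z = r1 by rewrite gez0_abs.
have n2E : (`|r2|%N)%:Z = r2 by rewrite gez0_abs.
exists (`|r1|%N, `|r2|%N), k, l, s, t; split => //=.
- by rewrite -ltz_nat PoszD n1E n2E.
- by apply/andP.
- by apply/andP.
- by rewrite /shifted /= !pmulrn !n1E !n2E.
Qed.

(** Move (0, 0), (1, 0) and (0, 1) into the parallelogram. If all three landed on one point, the
    edges would span the whole lattice and their determinant would divide 1. *)
Lemma not_unimodular_points (M d e : nat) u0 u1 w0 w1 :
  (d < M)%N -> (e < M)%N ->
  (u0.1 + u0.2 <= d)%N -> (u1.1 + u1.2 <= d)%N ->
  (w0.1 + w0.2 <= e)%N -> (w1.1 + w1.2 <= e)%N ->
  edge_det R u0 u1 w0 w1 != 0 ->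
  edge_det int u0 u1 w0 w1 \notin [:: 1; -1] ->
  exists c c', c != c' /\ forall k, k \in [:: c; c'] -> (k.1 + k.2 < d + e)%N /\
   exists s t : R, [/\ 0 < s < 1, 0 < t < 1,
   (shifted R M k).1 = u0.1%:R + w0.1%:R + s * (u1.1%:R - u0.1%:R) + t * (w1.1%:R - w0.1%:R) &
   (shifted R M k).2 = u0.2%:R + w0.2%:R + s * (u1.2%:R - u0.2%:R) + t * (w1.2%:R - w0.2%:R)].
Proof.
move=> dM eM hu0 hu1 hw0 hw1 D0 D1.
have pt p1 p2 := parallelogram_point p1 p2 dM eM hu0 hu1 hw0 hw1 D0.
have [c [k [l [s [t [cde s01 t01 [c1 c2] [z1 z2]]]]]]] := pt 0 0.
have [c' [k' [l' [s' [t' [cde' s01' t01' [c1' c2'] [z1' z2']]]]]]] := pt 1 0.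
have [c'' [k'' [l'' [s'' [t'' [cde'' s01'' t01'' [c1'' c2''] [z1'' z2'']]]]]]] := pt 0 1.
have [e'|ne'] := eqVneq c c'; last first.
  exists c, c'; split => // m; rewrite !inE => /orP[] /eqP ->; split => //.
    by exists s, t.
  by exists s', t'.
have [e''|ne''] := eqVneq c c''; last first.
  exists c, c''; split => // m; rewrite !inE => /orP[] /eqP ->; split => //.
    by exists s, t.
  by exists s'', t''.
exfalso; move/negP: D1; apply.
rewrite -e' in c1' c2'; rewrite -e'' in c1'' c2''.
set D := edge_det int u0 u1 w0 w1.
have DK : D * ((k' - k) * (l'' - l) - (k'' - k) * (l' - l)) = 1.
  transitivity (((k' - k) * (u1.1%:Z - u0.1%:Z) + (l' - l) * (w1.1%:Z - w0.1%:Z)) *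
    ((k'' - k) * (u1.2%:Z - u0.2%:Z) + (l'' - l) * (w1.2%:Z - w0.2%:Z)) -
    ((k' - k) * (u1.2%:Z - u0.2%:Z) + (l' - l) * (w1.2%:Z - w0.2%:Z)) *
    ((k'' - k) * (u1.1%:Z - u0.1%:Z) + (l'' - l) * (w1.1%:Z - w0.1%:Z))).
    by rewrite /D /edge_det !natz; ring.
  have -> : (k' - k) * (u1.1%:Z - u0.1%:Z) + (l' - l) * (w1.1%:Z - w0.1%:Z) = 1.
    by clear -c1 c1'; lia.
  have -> : (k'' - k) * (u1.2%:Z - u0.2%:Z) + (l'' - l) * (w1.2%:Z - w0.2%:Z) = 1.
    by clear -c2 c2''; lia.
  have -> : (k' - k) * (u1.2%:Z - u0.2%:Z) + (l' - l) * (w1.2%:Z - w0.2%:Z) = 0.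
    by clear -c2 c2'; lia.
  by rewrite mul0r subr0 mul1r.
have := congr1 absz DK; rewrite abszM => /eqP; rewrite muln_eq1 => /andP[/eqP D1 _].
by rewrite !inE; move: D1; clear; lia.
Qed.

Lemma bezout d e f g (s : seq (R * R)) : (0 < d)%N -> (0 < e)%N ->
  transversal d e f g -> uniq s -> (forall q, q \in s -> crossing d e f g q) ->
  (size s <= d * e)%N /\
  ((exists2 q, q \in s & ~ unimodular_at d e f g q) -> (size s < d * e)%N).
Proof.
move=> d0 e0 tr us scr.
pose M := (d + e)%N; have dM : (d < M)%N by rewrite /M; lia.
have eM : (e < M)%N by rewrite /M; lia.
have M1 : (1 < M)%N by rewrite /M; lia.
pose cell := dual_cell M d e f g.
pose fvertex q := exists2 w : nat * nat, maximal_exponents e g q w &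
  exists u0 u1 u2, [/\ maximal_exponents d f q u0, maximal_exponents d f q u1,
    maximal_exponents d f q u2 & edge_det R u0 u1 u0 u2 != 0].
pose gvertex q := exists2 w : nat * nat, maximal_exponents d f q w &
  exists u0 u1 u2, [/\ maximal_exponents e g q u0, maximal_exponents e g q u1,
    maximal_exponents e g q u2 & edge_det R u0 u1 u0 u2 != 0].
(* A shifted point of the Newton triangle of f lies in a triangle dual to a vertex of f; an exponent
   of g maximal there carries it into (d + e) Delta. *)
have vertex_f c : exists xc : (R * R) * (nat * nat), (c.1 + c.2 < d)%N ->
    [/\ (xc.2.1 + xc.2.2 < d + e)%N, cell xc.2 xc.1 & exists w,
       [/\ maximal_exponents e g xc.1 w, xc.2 = (c.1 + w.1, c.2 + w.2)%N & fvertex xc.1]].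
  have [cd|_] := ltnP (c.1 + c.2) d; last by exists ((0, 0), (0, 0)%N).
  have [x [u0 [u1 [u2 [l0 [l1 [l2 [[P0 P1 P2] [D0 l00 l10 l20 tri]]]]]]]]] :=
    dual_triangle f dM M1 cd.
  have [w Qw] := maximal_exponents_ex e g x.
  exists (x, (c.1 + w.1, c.2 + w.2)%N) => _ /=; split.
  - by case: (Qw) => + _; rewrite /exponents /=; lia.
  - exact: (triangle_dual_cell P0 P1 P2 Qw D0 l00 l10 l20 tri).
  - by exists w; split => //; exists w => //; exists u0, u1, u2.
have vertex_g c : exists xc : (R * R) * (nat * nat), (c.1 + c.2 < e)%N ->
    [/\ (xc.2.1 + xc.2.2 < d + e)%N, cell xc.2 xc.1 & exists w,
       [/\ maximal_exponents d f xc.1 w, xc.2 = (c.1 + w.1, c.2 + w.2)%N & gvertex xc.1]].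
  have [cd|_] := ltnP (c.1 + c.2) e; last by exists ((0, 0), (0, 0)%N).
  have [x [u0 [u1 [u2 [l0 [l1 [l2 [[P0 P1 P2] [D0 l00 l10 l20 tri]]]]]]]]] :=
    dual_triangle g eM M1 cd.
  have [w Qw] := maximal_exponents_ex d f x.
  exists (x, (c.1 + w.1, c.2 + w.2)%N) => _ /=; split.
  - by case: (Qw) => + _; rewrite /exponents /=; lia.
  - apply: dual_cellC.
    exact: (triangle_dual_cell P0 P1 P2 Qw D0 l00 l10 l20 tri).
  - by exists w; split => //; exists w => //; exists u0, u1, u2.
have mixed q : exists c : nat * nat, q \in s -> (c.1 + c.2 < d + e)%N /\ cell c q.
  have [/scr[u0 [u1 [w0 [w1 [P0 P1 Q0 Q1 D0]]]]]|_] := boolP (q \in s); last by exists (0, 0)%N.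
  have [c [_ [_ [s' [t [cde s01 t01 _ [z1 z2]]]]]]] :=
    parallelogram_point 0 0 dM eM P0.1 P1.1 Q0.1 Q1.1 D0.
  by exists c => _; split => //; apply: (parallelogram_dual_cell P0 P1 Q0 Q1 D0 s01 t01).
have [F FP] := choice vertex_f; have [G GP] := choice vertex_g.
have [C CP] := choice mixed.
have crossing_not_vertex q : q \in s -> ~ fvertex q /\ ~ gvertex q.
  move=> /scr[u0 [u1 [w0 [w1 [P0 P1 Q0 Q1 D0]]]]]; split.
    move=> [w _ [v0 [v1 [v2 [V0 V1 V2 D]]]]]; move/eqP: D0; apply.
    by rewrite (transversal_l tr V0 V1 V2 D Q0 Q1) /edge_det; ring.
  move=> [w _ [v0 [v1 [v2 [V0 V1 V2 D]]]]]; move/eqP: D0; apply.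
  by rewrite (transversal_r tr V0 V1 V2 D P0 P1) /edge_det; ring.
have fvertex_not_gvertex q : fvertex q -> ~ gvertex q.
  move=> [w _ [v0 [v1 [v2 [V0 V1 V2 D]]]]] [w' _ [v0' [v1' [v2' [V0' V1' V2' D']]]]].
  move/eqP: D'; apply.
  by rewrite (transversal_l tr V0 V1 V2 D V0' V1') /edge_det; ring.
pose Ld := exps d.-1; pose Le := exps e.-1; pose Lde := exps (d + e).-1.
have LdP c : c \in Ld -> (c.1 + c.2 < d)%N by rewrite mem_exps -ltnS prednK.
have LeP c : c \in Le -> (c.1 + c.2 < e)%N by rewrite mem_exps -ltnS prednK.
have LdeP c : (c.1 + c.2 < d + e)%N -> c \in Lde.
  by move=> h; rewrite mem_exps -ltnS prednK// addn_gt0 d0.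
pose T := [seq C q | q <- s] ++ [seq (F c).2 | c <- Ld] ++ [seq (G c).2 | c <- Le].
have sub_T : {subset T <= Lde}.
  move=> c; rewrite mem_cat => /orP[/mapP[k]|].
    by move=> /CP[h _] ->; exact: (LdeP _ h).
  rewrite mem_cat => /orP[] /mapP[k].
    by move=> /LdP/FP[h _ _] ->; exact: (LdeP _ h).
  by move=> /LeP/GP[h _ _] ->; exact: (LdeP _ h).
(* The image point determines the vertex, where transversality leaves g a single maximal exponent to
   subtract. *)
have F_inj : {in Ld &, injective (fun c => (F c).2)}.
  move=> c c' /LdP/FP[_ ce [w [Qw E _]]] /LdP/FP[_ ce' [w' [Qw' E' [_ _ [v0 [v1 [v2 [V0 V1 V2 D]]]]]]]] e1.
  rewrite e1 in ce; have xx := dual_cell_inj ce ce'.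
  rewrite xx in Qw; have ww := transversal_l tr V0 V1 V2 D Qw Qw'.
  move: e1; rewrite E E' ww => -[h1 h2].
  by rewrite [c]surjective_pairing [c']surjective_pairing (addIn h1) (addIn h2).
have G_inj : {in Le &, injective (fun c => (G c).2)}.
  move=> c c' /LeP/GP[_ ce [w [Qw E _]]] /LeP/GP[_ ce' [w' [Qw' E' [_ _ [v0 [v1 [v2 [V0 V1 V2 D]]]]]]]] e1.
  rewrite e1 in ce; have xx := dual_cell_inj ce ce'.
  rewrite xx in Qw; have ww := transversal_r tr V0 V1 V2 D Qw Qw'.
  move: e1; rewrite E E' ww => -[h1 h2].
  by rewrite [c]surjective_pairing [c']surjective_pairing (addIn h1) (addIn h2).
have C_inj : {in s &, injective C}.
  move=> q q' /CP[_ cq] /CP[_ cq'] e1; rewrite e1 in cq; exact: dual_cell_inj cq cq'.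
have F_cell c : c \in [seq (F c).2 | c <- Ld] -> exists2 q, cell c q & fvertex q.
  by move=> /mapP[k /LdP/FP[_ ck [w [_ _ fl]]] ->]; exists (F k).1.
have G_cell c : c \in [seq (G c).2 | c <- Le] -> exists2 q, cell c q & gvertex q.
  by move=> /mapP[k /LeP/GP[_ ck [w [_ _ fl]]] ->]; exists (G k).1.
have cell_notFG c q : q \in s -> cell c q ->
    c \notin [seq (F c).2 | c <- Ld] ++ [seq (G c).2 | c <- Le].
  move=> qs cq; have [nf ng] := crossing_not_vertex q qs.
  rewrite mem_cat; apply/negP => /orP[/F_cell[q' cq' h]|/G_cell[q' cq' h]].
    by apply: nf; rewrite (dual_cell_inj cq cq').
  by apply: ng; rewrite (dual_cell_inj cq cq').
have uniq_T : uniq T.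
  rewrite cat_uniq map_inj_in_uniq// us andTb; apply/andP; split.
    apply/hasPn => c cFG; apply/mapP => -[q qs cE].
    have [_ cq] := CP q qs; rewrite -cE in cq.
    by move/negP: (cell_notFG c q qs cq); apply.
  rewrite cat_uniq !map_inj_in_uniq// !uniq_exps andbT andTb.
  apply/hasPn => c /G_cell[q cq gq]; apply/negP => /F_cell[q' cq' fq'].
  by apply: (fvertex_not_gvertex q) => //; rewrite (dual_cell_inj cq cq').
have size_T : size T = (size s + size Ld + size Le)%N.
  by rewrite /T size_cat size_cat !size_map addnA.
have szd := size_exps d.-1; have sze := size_exps e.-1; have szde := size_exps (d + e).-1.
rewrite -/Ld -/Le -/Lde in szd sze szde.
have [d' dE] : exists d', d = d'.+1 by exists d.-1; lia.
have [e' eE] : exists e', e = e'.+1 by exists e.-1; lia.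
have sz : (size Lde = d * e + size Ld + size Le)%N.
  move: szd sze szde; clear -dE eE; rewrite dE eE /= addnS /=; nia.
split.
  have := uniq_leq_size uniq_T sub_T; rewrite size_T sz; clear; lia.
move=> [q qs /existsNP[u0 /existsNP[u1 /existsNP[w0 /existsNP[w1]]]]].
move=> /not_implyP[P0 /not_implyP[P1 /not_implyP[u01 /not_implyP[Q0 /not_implyP[Q1 /not_implyP[w01 /negP D1]]]]]].
have D0 := transversal_det tr P0 P1 u01 Q0 Q1 w01.
have [c [c' [cc' ccP]]] := not_unimodular_points dM eM P0.1 P1.1 Q0.1 Q1.1 D0 D1.
have cellP k : k \in [:: c; c'] -> (k.1 + k.2 < d + e)%N /\ cell k q.
  move=> /ccP[kde [s' [t [s01 t01 z1 z2]]]]; split => //.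
  exact: (parallelogram_dual_cell P0 P1 Q0 Q1 D0 s01 t01).
(* Of the two shifted points in the cell of [q], one was not counted in [T] and lengthens it. *)
have [k kcc kC] : exists2 k, k \in [:: c; c'] & k != C q.
  have [e1|] := eqVneq c (C q); last by exists c; rewrite ?mem_head.
  by exists c'; rewrite ?inE ?eqxx ?orbT// -e1 eq_sym.
have [kde kq] := cellP k kcc.
have uniq_kT : uniq (k :: T).
  rewrite cons_uniq uniq_T andbT mem_cat negb_or (cell_notFG k q qs kq) andbT.
  apply/mapP => -[q' q's kE]; move/eqP: kC; apply.
  have [_ cq'] := CP q' q's; rewrite -kE in cq'.
  by rewrite kE (dual_cell_inj kq cq').
have sub_kT : {subset k :: T <= Lde}.
  by move=> m; rewrite inE => /orP[/eqP ->|/sub_T//]; exact: LdeP.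
have := uniq_leq_size uniq_kT sub_kT; rewrite [size (k :: T)]/= size_T sz; clear; lia.
Qed.

End Bezout.

(** * Interpolation *)

Section Perturbation.
Variable R : realType.
Implicit Types (f g : nat -> nat -> R) (q : R * R).

Lemma transversal_perturbation d e f g (s : seq (R * R)) (eta : R) : 0 < eta ->
  uniq s -> (forall q, q \in s -> crossing d e f g q) ->
  exists g' (h : R * R -> R * R), [/\ transversal d e f g', {in s &, injective h} &
    forall q, q \in s -> [/\ `|(h q).1 - q.1| < eta, `|(h q).2 - q.2| < eta
                           & crossing d e f g' (h q)]].
Proof.
move=> eta0 us scr.
have : \forall t \near 0^'+, forall q, q \in s -> forall q', q' \in s -> q != q' ->
    2 * t < `|q.1 - q'.1| \/ 2 * t < `|q.2 - q'.2|.
  apply: near_seq => q _; apply: near_seq => q' _.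
  have [->|qq'] := eqVneq q q'; first by near=> t.
  have [e1|n1] := eqVneq q.1 q'.1.
    have n2 : q.2 != q'.2.
      apply: contraNneq qq' => e2.
      by rewrite [q]surjective_pairing [q']surjective_pairing e1 e2.
    near=> t => _; right.
    have : t < `|q.2 - q'.2| / 2.
      by near: t; apply: nbhs_right_lt; rewrite divr_gt0// normr_gt0 subr_eq0.
    by rewrite ltr_pdivlMr// mulrC.
  near=> t => _; left.
  have : t < `|q.1 - q'.1| / 2.
    by near: t; apply: nbhs_right_lt; rewrite divr_gt0// normr_gt0 subr_eq0.
  by rewrite ltr_pdivlMr// mulrC.
move=> sep.
(* Distinct points are more than [2 * ep] apart in some coordinate, so moving each by less than [ep]
   keeps them distinct. *)
have [ep [ep0 ep_eta sep_ep]] : exists ep, [/\ 0 < ep, ep < eta &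
   forall q, q \in s -> forall q', q' \in s -> q != q' ->
    2 * ep < `|q.1 - q'.1| \/ 2 * ep < `|q.2 - q'.2|].
  have /filter_ex[ep [/andP[? ?] ?]] : \forall t \near 0^'+, (0 < t < eta) /\
     forall q, q \in s -> forall q', q' \in s -> q != q' ->
    2 * t < `|q.1 - q'.1| \/ 2 * t < `|q.2 - q'.2|.
    near=> t; split; last by near: t.
    by apply/andP; split; near: t; [exact: nbhs_right_gt | exact: nbhs_right_lt].
  by exists ep.
have persist : \forall t \near 0^'+, forall q, q \in s -> exists q',
    [/\ `|q'.1 - q.1| < ep, `|q'.2 - q.2| < ep, two_maximal d f q' &
      two_maximal e (translate g (t * 1, t * (d + e).+1%:R)) q'].
  apply: near_seq => q qs.
  exact: (@crossing_persists R d e f g q (1, (d + e).+1%:R) ep ep0 (scr q qs)).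
have [t [tr tP]] := filter_ex (filterI (near_transversal d e f g) persist).
set g' := translate g _ in tr.
have : forall q, exists q', q \in s ->
    [/\ `|q'.1 - q.1| < ep, `|q'.2 - q.2| < ep, two_maximal d f q' & two_maximal e g' q'].
  move=> q; have [qs|_] := boolP (q \in s); last by exists q.
  by have [q' h] := tP q qs; exists q'.
move=> /choice[h hP]; exists g', h; split => //.
  move=> q q' qs q's hq; apply: contrapT => /eqP /(sep_ep q qs q' q's).
  have [a1 a2 _ _] := hP q qs; have [b1 b2 _ _] := hP q' q's.
  move: a1 a2 b1 b2; rewrite hq !ltr_norml => /andP[? ?] /andP[? ?] /andP[? ?] /andP[? ?].
  by case; apply/negP; rewrite -leNgt ler_norml; apply/andP; split; lra.
move=> q qs; have [a1 a2 [u0 [u1 [P0 P1 u01]]] [w0 [w1 [Q0 Q1 w01]]]] := hP q qs.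
split; [exact: lt_trans ep_eta | exact: lt_trans ep_eta |].
by exists u0, u1, w0, w1; split => //; exact: (transversal_det tr P0 P1 u01 Q0 Q1 w01).
Unshelve. all: by end_near. Qed.

Lemma crossing_bound d e f g (s : seq (R * R)) : (0 < d)%N -> (0 < e)%N ->
  uniq s -> (forall q, q \in s -> crossing d e f g q) -> (size s <= d * e)%N.
Proof.
move=> d0 e0 us scr.
have [g' [h [tr h_inj hP]]] := transversal_perturbation ltr01 us scr.
have uh : uniq (map h s) by rewrite map_inj_in_uniq.
have hc q : q \in map h s -> crossing d e f g' q by move=> /mapP[q' /hP[_ _ +] ->].
by have [+ _] := bezout d0 e0 tr uh hc; rewrite size_map.
Qed.

(** A list that misses a point of [Z] can be extended by it, and this stops before length B + 1.
    With [crossing_bound] it lists the stable points. *)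
Lemma exhaust_set (Z : set (R * R)) (B : nat) :
  (forall s, uniq s -> (forall q, q \in s -> Z q) -> (size s <= B)%N) ->
  exists s : seq (R * R), uniq s /\ forall q, q \in s <-> Z q.
Proof.
move=> ZB.
have step n : (exists s : seq (R * R), uniq s /\ forall q, q \in s <-> Z q) \/
    exists s : seq (R * R), [/\ uniq s, size s = n & forall q, q \in s -> Z q].
  elim: n => [|n [?|[s [us sn sZ]]]]; [by right; exists [::] | by left |].
  have [h|/existsNP[q /not_implyP[Zq qs]]] := pselect (forall q, Z q -> q \in s).
    by left; exists s; split => // q; split; [exact: sZ | exact: h].
  right; exists (q :: s); split => //=.
  - by rewrite us andbT; apply/negP.
  - by rewrite sn.
  - by move=> q'; rewrite inE => /orP[/eqP ->//|]; exact: sZ.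
have [//|[s [us sn sZ]]] := step B.+1.
by have := ZB s us sZ; rewrite sn ltnn.
Qed.

(* -(f + g)(q) is minus the tropical Jacobian of f and g at q, and the shift by
   (1, 1) turns exponents of degree at most d + e - 3 into interior points of
   (d + e) Delta. *)
Lemma crossings_row_dependent d e f g (s : seq (R * R)) : (0 < d)%N -> (0 < e)%N ->
  transversal d e f g -> uniq s -> (forall q, q \in s -> crossing d e f g q) ->
  size s = (d * e)%N ->
  forall u : nat * nat, (u.1 + u.2 + 2 < d + e)%N -> exists q1 q2,
  [/\ q1 \in s, q2 \in s, q1 != q2 &
   let w q := - (tropical_value d f q + tropical_value e g q) + dot (1, 1)%N q + dot u q in
   (forall q, q \in s -> w q <= w q1) /\ (forall q, q \in s -> w q <= w q2)].
Proof.
move=> d0 e0 tr us scr sde u ude.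
pose w q := - (tropical_value d f q + tropical_value e g q) + dot (1, 1)%N q + dot u q.
have um q : q \in s -> unimodular_at d e f g q.
  move=> qs; apply: contrapT => nu.
  have [_ lt] := bezout d0 e0 tr us scr.
  by have := lt (ex_intro2 _ _ q qs nu); rewrite sde ltnn.
(* The bound is already reached, so there is no further crossing; this catches the point that
   [second_crossing] returns. *)
have full x : crossing d e f g x -> x \in s.
  move=> xc; apply: contrapT => /negP xs.
  have uxs : uniq (x :: s) by rewrite /= xs us.
  have cxs q : q \in x :: s -> crossing d e f g q.
    by rewrite inE => /orP[/eqP ->//|]; exact: scr.
  by have [+ _] := bezout d0 e0 tr uxs cxs; rewrite /= sde ltnn.
have [q0 q0s] : exists q, q \in s.
  case: s sde {us scr um full} => [|q s _]; last by exists q; rewrite mem_head.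
  by move=> /eqP; rewrite /= eq_sym muln_eq0; lia.
have [q qs qmax] := seq_argmax w q0s.
have [|x [xq xc xle]] := @second_crossing R d e f g q u.1.+1 u.2.+1 tr (scr q qs) (um q qs) isT isT.
  by lia.
have wx : w q <= w x.
  have wE y : w y = - (tropical_value d f y + tropical_value e g y - dot (u.1.+1, u.2.+1) y).
    by rewrite /w /dot /= -!natr1; ring.
  by rewrite !wE lerN2.
exists q, x; split => //; [exact: full | by rewrite eq_sym | split => //].
by move=> q' q's; apply: le_trans wx; exact: qmax.
Qed.

End Perturbation.

(** * The curve through the given points *)

Lemma value_group_addr_closed (R : realType) (K : fieldType) (v : K -> R) :
  rank_one_valuation v ->
  forall x y, value_group v x -> value_group v y -> value_group v (x + y).
Proof.
move=> hv _ _ [a a0 <-] [b b0 <-]; exists (a * b); first by rewrite /= mulf_neq0.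
exact: valuation_mul.
Qed.

Lemma interpolation (R : realType) (T : set R) (m n : nat) (r : 'I_n -> R * R) :
  T 0 -> (forall x y, T x -> T y -> T (x + y)) ->
  n = size (exps m) -> (forall i, (T `*` T) (r i)) ->
  tropically_singular (fun i j : 'I_n => dot (nth (0, 0)%N (exps m) j) (r i)) ->
  exists a, tropical_polynomial T m a /\ forall i, tropical_zeros T m a (r i).
Proof.
move=> T0 TD nE rT sing.
have Tn k x : T x -> T (k%:R * x).
  by move=> Tx; elim: k => [|k IH]; rewrite ?mul0r// -natr1 mulrDl mul1r; exact: TD.
have [|c Tc cP] := tropically_singular_kernel T0 TD _ sing.
  by move=> i j; have [h1 h2] := rT i; apply: TD; exact: Tn.
(* The column index is the position of the exponent in [exps m]; the default 0 is taken only outside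
   the degree bound. *)
pose a i j := oapp c 0 (insub (index (i, j) (exps m))).
have idx_lt u : u \in exps m -> (index u (exps m) < n)%N by rewrite nE index_mem.
have aE (j : 'I_n) : let u := nth (0, 0)%N (exps m) j in a u.1 u.2 = c j.
  rewrite /= /a -surjective_pairing index_uniq ?uniq_exps -?nE//.
  by rewrite valK.
have nthE u : u \in exps m -> exists j : 'I_n, nth (0, 0)%N (exps m) j = u.
  by move=> um; exists (Ordinal (idx_lt u um)); rewrite /= nth_index.
have monE i (j : 'I_n) : tropical_monomial a (nth (0, 0)%N (exps m) j) (r i) =
    dot (nth (0, 0)%N (exps m) j) (r i) + c j.
  by rewrite /tropical_monomial aE /dot; ring.
exists a; split => [u um|i].
  have [|j <-] := nthE u; first by rewrite mem_exps.
  by rewrite aE.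
split; first exact: rT.
have [j [j' [jj' jmax j'max]]] := cP i.
have maxE (k : 'I_n) : (forall l : 'I_n, dot (nth (0, 0)%N (exps m) l) (r i) + c l <=
     dot (nth (0, 0)%N (exps m) k) (r i) + c k) ->
   maximal_exponents m a (r i) (nth (0, 0)%N (exps m) k).
  move=> h; split; first by rewrite /exponents /= -mem_exps mem_nth// -nE.
  move=> w wm; have [|l <-] := nthE w; first by rewrite mem_exps.
  by rewrite !monE.
exists (nth (0, 0)%N (exps m) j), (nth (0, 0)%N (exps m) j'); split.
- exact: maxE.
- exact: maxE.
- apply/eqP; rewrite nth_uniq ?uniq_exps -?nE//.
Qed.

Theorem theorem49 (R : realType) (K : closedFieldType) (v : K -> R)
    (T : set R) (hv : rank_one_valuation v) (hT : T = value_group v)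
    (hQ : forall r : rat, T (ratr r))
    (d e l : nat) (hd : (3 <= d)%N) (he : (3 <= e)%N)
    (hl : l = (1 + (d ^ 2 + e ^ 2 - 3 * e - 3 * d) %/ 2)%N)
    (f g : nat -> nat -> R)
    (hf : tropical_polynomial T d f) (hg : tropical_polynomial T e g)
    (p : 'I_l -> R * R) (hp : forall i, (T `*` T) (p i)) :
  exists C : set (R * R),
    [/\ tropical_curve T (d + e - 3) C,
        (forall q, stable_intersection T d e f g q != 0 -> C q)
      & (forall i, C (p i))].
Proof.
have T0 : T 0 by have := hQ 0; rewrite rmorph0.
have TD : forall x y, T x -> T y -> T (x + y).
  by rewrite hT; exact: value_group_addr_closed.
have d0 : (0 < d)%N by lia.
have e0 : (0 < e)%N by lia.
pose Z : set (R * R) := [set q | stable_intersection T d e f g q != 0].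
have ZP q : Z q -> (T `*` T) q /\ crossing d e f g q by exact: stable_intersection_crossing.
have [s [us sZ]] : exists s : seq (R * R), uniq s /\ forall q, q \in s <-> Z q.
  apply: (@exhaust_set R Z (d * e)) => s us sZ.
  apply: (@crossing_bound R d e f g s) => // q /sZ Zq; exact: (ZP q Zq).2.
have scr q : q \in s -> crossing d e f g q by move=> /sZ/ZP[].
have sde : (size s <= d * e)%N := crossing_bound d0 e0 us scr.
set m := (d + e - 3)%N; pose n := size (exps m).
have nE : n = (d * e + l)%N.
  have h := size_exps m; rewrite -/n in h.
  (* The halving is exact, since d(d - 3) and e(e - 3) are even. *)
  have l2 : (2 * l = 2 + (d * (d - 3) + e * (e - 3)))%N.
    rewrite hl; have -> : (d ^ 2 + e ^ 2 - 3 * e - 3 * d = d * (d - 3) + e * (e - 3))%N.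
      by rewrite -!mulnn; clear -hd he; nia.
    rewrite mulnDr [(2 * (_ %/ 2))%N]mulnC divnK// dvdn2.
    by rewrite oddD !oddM !oddB//=; case: (odd d); case: (odd e).
  have [d' dE] : exists d', d = d'.+3 by exists (d - 3)%N; lia.
  have [e' eE] : exists e', e = e'.+3 by exists (e - 3)%N; lia.
  move: h l2; rewrite /m; move: (n) => k; rewrite dE eE.
  have -> : (d'.+3 + e'.+3 - 3 = d' + e' + 3)%N by lia.
  by rewrite !subSS !subn0; clear; nia.
have l0 : (0 < l)%N by rewrite hl.
pose p0 := p (Ordinal l0).
pose ps := [seq p i | i <- enum 'I_l].
have size_ps : size ps = l by rewrite size_map size_enum_ord.
(* With fewer than d e distinct stable points the list is too short, and the default [p0] fills the
   last rows. *)
pose r (i : 'I_n) := nth p0 (s ++ ps) i.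
have rT i : (T `*` T) (r i).
  rewrite /r; have [h|h] := ltnP i (size (s ++ ps)); last first.
    by rewrite nth_default//; exact: hp.
  have := mem_nth p0 h; rewrite mem_cat => /orP[/sZ/ZP[]//|/mapP[k _ ->]]; exact: hp.
suff sing : tropically_singular (fun i j : 'I_n => dot (nth (0, 0)%N (exps m) j) (r i)).
  have [a [aT aZ]] := interpolation T0 TD erefl rT sing.
  exists (tropical_zeros T m a); split; first by exists a.
    move=> q /sZ qs.
    have qn : (index q s < n)%N by rewrite nE; apply: ltn_addr; rewrite (leq_trans _ sde)// index_mem.
    by have := aZ (Ordinal qn); rewrite /r /= nth_cat index_mem qs nth_index.
  move=> i.
  have hin : (size s + i < n)%N by rewrite nE; have := ltn_ord i; lia.
  have := aZ (Ordinal hin); rewrite /r /= nth_cat ltnNge leq_addr /= addKn.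
  by rewrite (nth_map i) ?size_enum_ord// nth_ord_enum.
(* In that case the first row of the given points and the last, padded row both belong to [p0]; two
   equal rows are dependent. *)
have [slt|sge] := ltnP (size s) (d * e).
  have h1 : (size s < n)%N by rewrite nE; lia.
  have h2 : (n.-1 < n)%N by rewrite nE; lia.
  pose i1 := Ordinal h1; pose i2 := Ordinal h2.
  have r1 : r i1 = p0.
    rewrite /r /= nth_cat ltnn subnn (nth_map (Ordinal l0)) ?size_enum_ord//.
    by rewrite /p0; congr p; apply: val_inj; rewrite /= nth_enum_ord.
  have r2 : r i2 = p0.
    rewrite /r nth_default// size_cat size_ps -[nat_of_ord i2]/(n.-1) nE.
    by move: slt (l0); clear; lia.
  apply: (@row_dependent_tropically_singular _ _ _ [set i1; i2]%SET (fun=> 0)).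
    by apply/set0Pn; exists i1; rewrite !inE eqxx.
  move=> j; exists i1, i2; rewrite !inE !eqxx orbT; split => //.
  - rewrite -val_eqE -[val i1]/(size s) -[val i2]/(n.-1) neq_ltn nE.
    by apply/orP; left; move: slt (l0); clear; lia.
  - by move=> k; rewrite !inE => /orP[] /eqP ->; rewrite ?r1 ?r2.
  - by move=> k; rewrite !inE => /orP[] /eqP ->; rewrite ?r1 ?r2.
have {sde sge} sE : size s = (d * e)%N by apply/eqP; rewrite eqn_leq sde.
apply: contrapT => nsing.
have [eta eta0 sep] := tropically_nonsingular_open nsing.
(* A row entry has exponents of sum at most m, so moving a point by less than eta / c in each
   coordinate changes it by at most m eta / c, which is at most eta. *)
pose c : R := (2 * m).+1%:R.
have c0 : 0 < c by rewrite ltr0n.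
have [g' [h [tr h_inj hP]]] := transversal_perturbation (divr_gt0 eta0 c0) us scr.
pose r' (i : 'I_n) := if (i < size s)%N then h (r i) else r i.
have rs (i : 'I_n) : (i < size s)%N -> r i \in s by move=> si; rewrite /r nth_cat si mem_nth.
apply: (sep (fun i j : 'I_n => dot (nth (0, 0)%N (exps m) j) (r' i))).
  move=> i j; rewrite /r'; case: ifPn => [si|_]; last by rewrite subrr normr0 ltW.
  have [h1 h2 _] := hP _ (rs i si).
  have : nth (0, 0)%N (exps m) j \in exps m by rewrite mem_nth.
  rewrite mem_exps; set u := nth _ _ _ => um.
  have -> : dot u (h (r i)) - dot u (r i) =
    u.1%:R * ((h (r i)).1 - (r i).1) + u.2%:R * ((h (r i)).2 - (r i).2).
    by rewrite /dot; ring.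
  apply: (le_trans (ler_normD _ _)); rewrite !normrM !normr_nat.
  apply: (@le_trans _ _ (u.1%:R * (eta / c) + u.2%:R * (eta / c))).
    by apply: lerD; apply: ler_wpM2l => //; exact: ltW.
  rewrite -mulrDl -natrD mulrCA ger_pMr// ler_pdivrMr// mul1r ler_nat.
  by apply: (leq_trans um); rewrite mul2n -addnn; apply: leqW; exact: leq_addr.
have hc q : q \in map h s -> crossing d e f g' q by move=> /mapP[q' /hP[_ _ +] ->].
have uh : uniq (map h s) by rewrite map_inj_in_uniq.
have ude k : (k <= m)%N -> (k + 2 < d + e)%N by rewrite /m; clear -hd he; lia.
have dep := crossings_row_dependent d0 e0 tr uh hc.
rewrite size_map in dep; move/(_ sE): dep => dep.
have r'h (i : 'I_n) : (i < size s)%N -> r' i \in map h s.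
  by move=> si; rewrite /r' si map_f// rs.
have onto q : q \in map h s -> exists2 i : 'I_n, (i < size s)%N & r' i = q.
  move=> /mapP[q' q's ->].
  have qi : (index q' s < size s)%N by rewrite index_mem.
  have qn : (index q' s < n)%N by rewrite nE -sE ltn_addr.
  by exists (Ordinal qn) => //; rewrite /r' /= qi /r /= nth_cat qi nth_index.
(* The row weights of the Euler-Jacobi dependency; they do not depend on the column [j]. *)
pose wt q := - (tropical_value d f q + tropical_value e g' q) + dot (1, 1)%N q.
apply: (@row_dependent_tropically_singular _ _ _ [set i : 'I_n | (i < size s)%N]%SET
  (fun i => wt (r' i))).
  have hn : (0 < n)%N by rewrite nE; lia.
  apply/set0Pn; exists (Ordinal hn); rewrite inE /= sE; lia.
move=> j.
have : nth (0, 0)%N (exps m) j \in exps m by rewrite mem_nth.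
rewrite mem_exps; set u := nth _ _ _ => um.
have [|q1 [q2 [q1s q2s q12 [max1 max2]]]] := dep u; first exact: ude.
have [i1 si1 r1] := onto _ q1s; have [i2 si2 r2] := onto _ q2s.
exists i1, i2; rewrite !inE; split => //.
- by apply: contraNneq q12 => i12; rewrite -r1 -r2 i12.
- by move=> k; rewrite inE => sk; rewrite r1; exact: max1 (r'h k sk).
- by move=> k; rewrite inE => sk; rewrite r2; exact: max2 (r'h k sk).
Qed.
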